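(* Let $A$ be a positively graded Noetherian $k$-algebra, let $e$ be a primitive idempotent of $A$ of degree zero, let $\Gamma=(1-e)A(1-e)$ and $S_e=eA/e\,\mathrm{rad}A$. Assume that $\mathrm{Ext}^1_A(S_e,S_e)=0$. If both $\mathrm{gl.dim}\,A$ and $\mathrm{gl.dim}\,\Gamma$ are finite, then $S_e$ is self-orthogonal, that is, $\mathrm{Ext}^i_A(S_e,S_e)=0$ for all $i>0$.
   Context: $k$ is an algebraically closed field. Algebras are associative and unital; Noetherian means left and right Noetherian. Positively graded means: $A=\bigoplus_{i\ge 0}A_i$ as vector spaces, where $A_0$ is a product of finitely many copies of $k$ and $A_iA_j=A_{i+j}$ for all $i,j\ge 0$. $\mathrm{rad}A$ denotes the graded Jacobson radical $\bigoplus_{i\ge1}A_i$. Of degree zero means lying in $A_0$. Modules are right modules and $\mathrm{Ext}$ is taken in the category of (ungraded) modules; $\mathrm{gl.dim}$ is the global dimension (left and right agree for Noetherian algebras). *)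

(* Defs.v *)
From HB Require Import structures.
From mathcomp Require Import all_boot all_algebra ring_quotient generic_quotient.
From mathcomp Require Import boolp.
From mathcomp.multinomials Require Import freeg.

Set Implicit Arguments.
Unset Strict Implicit.
Unset Printing Implicit Defensive.

Import GRing.Theory.
Local Open Scope ring_scope.
Local Open Scope quotient_scope.

(* A right R-module is an [lmodType R^c], where [R^c] is the converse ring:
   the action of a on m, written [a *: m] below, is the right product m a.
   In particular [R^c^o] is R as a right module over itself.
   [pzRingType] is used where the zero ring has to be allowed. *)

Section SubAndQuotientModules.
Variables (R : pzRingType) (V : lmodType R).

Section Sub.
Variable S : submodClosed V.

Definition submod_type : Type := {x : V | x \in S}.
HB.instance Definition _ := [isSub of submod_type for @sval V _].
HB.instance Definition _ := [Choice of submod_type by <:].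
HB.instance Definition _ := [SubChoice_isSubLmodule of submod_type by <:].

Definition submod_mem : V -> bool := fun x => x \in S.

Lemma submod_mem_closed : zmod_closed submod_mem.
Proof.
split=> [|x y Sx Sy]; first exact: (rpred0 S).
by apply: (rpredD Sx); rewrite -scaleN1r; apply: rpredZ.
Qed.

HB.instance Definition _ :=
  GRing.isZmodClosed.Build V submod_mem submod_mem_closed.

Definition quotmod : Type := 
  Quotient.quot (GRing.ZmodClosed.clone V submod_mem _).
HB.instance Definition _ := GRing.Zmodule.on quotmod.
HB.instance Definition _ := ZmodQuotient.on quotmod.

Definition quotmod_scale (a : R) (x : quotmod) : quotmod :=
  \pi_quotmod (a *: repr x).

Lemma quotmod_scale_pi a (x : V) :
  quotmod_scale a (\pi_quotmod x) = \pi_quotmod (a *: x).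
Proof.
apply/eqP; rewrite -[_ == _]Quotient.idealrBE -scalerBr rpredZ //.
by rewrite -[_ \in _]/(_ \in submod_mem) Quotient.idealrBE reprK.
Qed.

Lemma quotmod_scaleA a b x :
  quotmod_scale a (quotmod_scale b x) = quotmod_scale (a * b) x.
Proof. by elim/quotW: x => x; rewrite (quotmod_scale_pi b x) !quotmod_scale_pi scalerA. Qed.

Lemma quotmod_scale1 : left_id 1 quotmod_scale.
Proof. by elim/quotW => x; rewrite !quotmod_scale_pi scale1r. Qed.

Lemma quotmod_scaleDr : right_distributive quotmod_scale +%R.
Proof.
move=> a; elim/quotW => x; elim/quotW => y.
by rewrite -raddfD (quotmod_scale_pi a (x + y)) scalerDr raddfD !quotmod_scale_pi.
Qed.

Lemma quotmod_scaleDl x : {morph quotmod_scale^~ x : a b / a + b}.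
Proof.
by move=> a b; elim/quotW: x => x; rewrite !quotmod_scale_pi scalerDl raddfD.
Qed.

HB.instance Definition _ := GRing.Zmodule_isLmodule.Build R quotmod
  quotmod_scaleA quotmod_scale1 quotmod_scaleDr quotmod_scaleDl.

End Sub.
End SubAndQuotientModules.

Definition trivial_zmod (V : zmodType) : Prop := forall x : V, x = 0.

Definition noetherian_mod (R : pzRingType) (V : lmodType R) : Prop :=
  forall S : nat -> submodClosed V,
    (forall n, {subset S n <= S n.+1}) ->
    exists n, forall m, (n <= m)%N -> S m =i S n.

Definition noetherian (R : pzRingType) : Prop :=
  noetherian_mod R^o /\ noetherian_mod R^c^o.

Section Projective.
Variable R : pzRingType.

Definition projective (P : lmodType R) : Prop :=
  forall (M N : lmodType R) (g : {linear M -> N}) (f : {linear P -> N}),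
    (forall y, exists x, g x = y) ->
    exists h : {linear P -> M}, forall x, g (h x) = f x.

Record proj_resolution (M : lmodType R) := ProjResolution {
  res_mod : nat -> lmodType R;
  res_diff : forall i, {linear res_mod i.+1 -> res_mod i};
  res_aug : {linear res_mod 0 -> M};
  res_proj : forall i, projective (res_mod i);
  res_aug_surj : forall y, exists x, res_aug x = y;
  res_exact0 : forall x, res_aug x = 0 <-> exists y, x = res_diff 0 y;
  res_exactS : forall i x,
    res_diff i x = 0 <-> exists y, x = res_diff i.+1 y
}.

Definition pdim_le (n : nat) (M : lmodType R) : Prop :=
  exists P : proj_resolution M,
    forall i, (n < i)%N -> trivial_zmod (res_mod P i).

Definition finite_gldim : Prop :=
  exists n, forall M : lmodType R, pdim_le n M.

End Projective.

Section Hom.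
Variables (R : pzRingType) (U V : lmodType R).

Definition hom : Type := {linear U -> V}.
HB.instance Definition _ := gen_eqMixin hom.
HB.instance Definition _ := gen_choiceMixin hom.

Lemma homP (f g : hom) : (forall x, f x = g x) -> f = g.
Proof.
case: f g => [f cf] [g cg] /= /funext efg; subst g; congr GRing.Linear.Pack.
case: cf cg => [[fD] [fZ]] [[gD] [gZ]].
by congr (GRing.Linear.Class _ _); [congr Algebra.isNmodMorphism.Axioms_ |
  congr GRing.isScalable.Axioms_]; exact: Prop_irrelevance.
Qed.

Definition hom_zero : hom := \0 : {linear U -> V}.
Definition hom_opp (f : hom) : hom := \- f : {linear U -> V}.
Definition hom_add (f g : hom) : hom := f \+ g : {linear U -> V}.

Lemma hom_addA : associative hom_add.
Proof. by move=> f g h; apply: homP => x /=; rewrite addrA. Qed.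
Lemma hom_addC : commutative hom_add.
Proof. by move=> f g; apply: homP => x /=; rewrite addrC. Qed.
Lemma hom_add0 : left_id hom_zero hom_add.
Proof. by move=> f; apply: homP => x /=; rewrite add0r. Qed.
Lemma hom_addN : left_inverse hom_zero hom_opp hom_add.
Proof. by move=> f; apply: homP => x /=; rewrite addNr. Qed.

HB.instance Definition _ :=
  GRing.isZmodule.Build hom hom_addA hom_addC hom_add0 hom_addN.

End Hom.

Section Precomp.
Variables (R : pzRingType) (U U' V : lmodType R) (d : {linear U' -> U}).

Definition precomp (f : hom U V) : hom U' V := f \o d : {linear U' -> V}.

Lemma precomp_is_zmod_morphism : zmod_morphism precomp.
Proof. by move=> f g; apply: homP. Qed.

HB.instance Definition _ :=
  GRing.isZmodMorphism.Build (hom U V) (hom U' V) precomp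
    precomp_is_zmod_morphism.

End Precomp.

Section Homology.
Variables (X Y Z : zmodType) (f : {additive X -> Y}) (g : {additive Y -> Z}).

Definition ker_pred : pred Y := fun y => g y == 0.

Lemma ker_pred_closed : zmod_closed ker_pred.
Proof.
split=> [|x y]; rewrite /ker_pred !unfold_in ?raddf0 //.
by move=> /eqP gx /eqP gy; rewrite raddfB gx gy subrr.
Qed.

HB.instance Definition _ := GRing.isZmodClosed.Build Y ker_pred ker_pred_closed.

Definition ker_type : Type := {y : Y | y \in ker_pred}.
HB.instance Definition _ := [isSub of ker_type for @sval Y _].
HB.instance Definition _ := [Choice of ker_type by <:].
HB.instance Definition _ := [SubChoice_isSubZmodule of ker_type by <:].

Definition im_pred : pred ker_type := fun y => `[< exists x, val y = f x >].

Lemma im_pred_closed : zmod_closed im_pred.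
Proof.
split=> [|x y /asboolP[x' xE] /asboolP[y' yE]]; apply/asboolP.
  by exists 0; rewrite !raddf0.
by exists (x' - y'); rewrite !raddfB -xE -yE.
Qed.

HB.instance Definition _ :=
  GRing.isZmodClosed.Build ker_type im_pred im_pred_closed.

(* ker g / (im f :&: ker g), that is ker g / im f when g \o f = 0. *)
Definition homology : zmodType :=
  Quotient.quot (GRing.ZmodClosed.clone ker_type im_pred _).

Lemma homology_trivialP :
  trivial_zmod homology <->
  forall y, g y = 0 -> exists x, y = f x.
Proof.
split=> [H0 y gy0 | H].
  have ky : y \in ker_pred by apply/eqP.
  have /eqP := H0 (\pi_homology (Sub y ky : ker_type)).
  rewrite -[0](raddf0 \pi_homology) -[_ == _]Quotient.idealrBE subr0.
  by move/asboolP.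
elim/quotW=> y; rewrite -[0](raddf0 \pi_homology); apply/eqP.
rewrite -[_ == _]Quotient.idealrBE subr0; apply/asboolP/H.
exact/eqP/(valP y).
Qed.

End Homology.

Section ResolutionCohomology.
Variables (R : pzRingType) (M : lmodType R) (P : proj_resolution M).
Variable N : lmodType R.

Definition hom_diff (i : nat) :
    {additive hom (res_mod P i) N -> hom (res_mod P i.+1) N} :=
  precomp (res_diff P i).

Definition res_cohomology (i : nat) : zmodType :=
  if i is j.+1 then homology (hom_diff j) (hom_diff j.+1)
  else homology (\0 : {additive hom (res_mod P 0) N -> _}) (hom_diff 0).

End ResolutionCohomology.

Section FreeResolution.
Variable R : nzRingType.
Implicit Type M : lmodType R.

Definition free_mod M : lmodType R := {freeg M / R}.

Section Lift.
Variables (M N : lmodType R) (f : M -> N).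

Definition free_lift : free_mod M -> N := fglift f.

Lemma free_lift_is_zmod_morphism : zmod_morphism free_lift.
Proof. exact: lift_is_additive. Qed.

HB.instance Definition _ :=
  GRing.isZmodMorphism.Build (free_mod M) N free_lift
    free_lift_is_zmod_morphism.

Lemma free_lift_is_scalable : scalable free_lift.
Proof.
move=> a D; rewrite -[D]freeg_sumE scaler_sumr !(raddf_sum free_lift).
rewrite scaler_sumr; apply: eq_bigr => z _ /=.
transitivity (free_lift << (a * coeff z D) *g z >>).
  congr free_lift; apply/eqP/freeg_eqP => y.
  by rewrite coeffZ !coeffU mulrA.
by rewrite /free_lift !liftU scalerA.
Qed.

HB.instance Definition _ :=
  GRing.isScalable.Build R (free_mod M) N *:%R free_lift
    free_lift_is_scalable.

End Lift.

Lemma free_mod_projective M : projective (free_mod M).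
Proof.
move=> X Y g f gsurj; pose s (z : M) := projT1 (cid (gsurj (f << z >>))).
exists (free_lift s) => D; rewrite -[D]freeg_sumE !raddf_sum.
apply: eq_bigr => z _; rewrite /= {1}/free_lift liftU linearZ /=.
rewrite /s; case: cid => x /= ->; rewrite -linearZ /=; congr (f _).
by apply/eqP/freeg_eqP => y; rewrite coeffZ !coeffU mul1r.
Qed.

Definition free_eval M : {linear free_mod M -> M} := free_lift id.

Lemma free_eval_surj M (y : M) : exists x, free_eval M x = y.
Proof. by exists << y >>; rewrite [LHS]liftU scale1r. Qed.

Section Syzygy.
Variable M : lmodType R.

Definition syzygy_pred : pred (free_mod M) := fun x => free_eval M x == 0.

Lemma syzygy_pred_closed : subsemimod_closed syzygy_pred.
Proof.
split=> [|a x]; first split=> [|x y].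
- exact/eqP/(linear0 (free_eval M)).
- move=> /eqP x0 /eqP y0; apply/eqP/(etrans (linearD (free_eval M) x y)).
  by rewrite x0 y0 addr0.
move=> /eqP x0; apply/eqP/(etrans (linearZZ (free_eval M) a x)).
by rewrite x0 scaler0.
Qed.

HB.instance Definition _ :=
  GRing.isSubmodClosed.Build R (free_mod M) syzygy_pred syzygy_pred_closed.

Definition syzygy : lmodType R :=
  submod_type (GRing.SubmodClosed.clone R (free_mod M) syzygy_pred _).

Definition syzygy_incl : {linear syzygy -> free_mod M} := val.

End Syzygy.

Fixpoint syz M n : lmodType R := if n is m.+1 then syzygy (syz M m) else M.

Definition free_diff M n :
    {linear free_mod (syz M n.+1) -> free_mod (syz M n)} :=
  @syzygy_incl (syz M n) \o free_eval (syz M n.+1).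

Lemma syzygy_exact N (x : free_mod N) :
  free_eval N x = 0 <->
  exists y, x = @syzygy_incl N (free_eval (syzygy N) y).
Proof.
split=> [/eqP x0 | [y ->]]; last exact/eqP/(valP (free_eval _ y)).
have [y yx] := free_eval_surj (Sub x x0 : syzygy N).
by exists y; rewrite yx.
Qed.

Lemma free_diff_exact M i x :
  free_diff M i x = 0 <-> exists y, x = free_diff M i.+1 y.
Proof.
rewrite -syzygy_exact /free_diff /=.
have incl0 := linear0 (@syzygy_incl (syz M i)).
by split=> [x0 | ->] //; apply: val_inj; rewrite [LHS]x0 -incl0.
Qed.

Definition free_resolution M : proj_resolution M :=
  {| res_diff := free_diff M;
     res_proj := fun i => @free_mod_projective (syz M i);
     res_aug_surj := @free_eval_surj M;
     res_exact0 := @syzygy_exact M;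
     res_exactS := @free_diff_exact M |}.

Definition Ext (M N : lmodType R) (i : nat) : zmodType :=
  res_cohomology (free_resolution M) N i.

End FreeResolution.

Section PositivelyGraded.
Variables (k : closedFieldType) (A : algType k).

(* The subspace S T, spanned by the products s t. *)
Definition mul_space (S T : {pred A}) (x : A) : Prop :=
  exists n (s t : 'I_n -> A),
    [/\ forall i, s i \in S, forall i, t i \in T & x = \sum_i s i * t i].

Record pos_grading := PosGrading {
  gr : nat -> submodClosed A;
  gr_span : forall x, exists n (a : nat -> A),
    (forall i, a i \in gr i) /\ x = \sum_(i < n) a i;
  gr_direct : forall n (a : nat -> A),
    (forall i, a i \in gr i) -> \sum_(i < n) a i = 0 ->
    forall i, (i < n)%N -> a i = 0;
  gr0_split : exists n (phi : {rmorphism {ffun 'I_n -> k^o} -> A}),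
    [/\ scalable phi, injective phi &
       forall x, x \in gr 0 <-> exists c, x = phi c];
  gr_mul : forall i j x, x \in gr (i + j) <-> mul_space (gr i) (gr j) x
}.

Variable G : pos_grading.

(* rad A, the direct sum of the A_i for i > 0. *)
Definition graded_rad : {pred A} := fun x =>
  `[< exists n (a : nat -> A),
        (forall i, a i \in gr G i.+1) /\ x = \sum_(i < n) a i >].

Lemma graded_rad_hom i x : x \in gr G i.+1 -> x \in graded_rad.
Proof.
move=> xi; apply/asboolP; exists i.+1, (fun j => if j == i then x else 0).
split=> [j|]; first by case: eqP => [->|_] //; apply: rpred0.
rewrite (bigD1 ord_max) //= eqxx big1 ?addr0 // => j /negPf.
by rewrite -val_eqE /= => ->.
Qed.

Lemma graded_rad0 : 0 \in graded_rad.
Proof. exact/(@graded_rad_hom 0)/rpred0. Qed.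

Lemma graded_radD x y :
  x \in graded_rad -> y \in graded_rad -> x + y \in graded_rad.
Proof.
move=> /asboolP[n [a [aG ->]]] /asboolP[m [b [bG ->]]]; apply/asboolP.
exists (n + m)%N, (fun i => (if (i < n)%N then a i else 0) +
                            (if (i < m)%N then b i else 0)).
split=> [i|]; first by rewrite rpredD //; case: ifP => _; rewrite ?rpred0.
rewrite big_split /= (big_ord_widen (n + m) a) ?leq_addr //.
by rewrite (big_ord_widen (n + m) b) ?leq_addl // -!big_mkcond.
Qed.

Lemma graded_radM x y : x \in graded_rad -> x * y \in graded_rad.
Proof.
move=> /asboolP[n [a [aG ->]]]; have [m [b [bG ->]]] := gr_span G y.
have radI := big_ind (fun z => z \in graded_rad) graded_rad0 graded_radD.
rewrite mulr_suml; apply: (@radI) => i _; rewrite mulr_sumr; apply: (@radI) => j _.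
apply: (@graded_rad_hom (i + j)); rewrite -addSn; apply/gr_mul.
by exists 1%N, (fun=> a i), (fun=> b j); split=> //; rewrite big_ord1.
Qed.

(* The right module eA. *)
Definition eA (e : A) : pred A^c^o := fun x => `[< exists a : A, x = e * a >].

Lemma eA_closed e : subsemimod_closed (eA e).
Proof.
split=> [|a x /asboolP[b ->]]; first split=> [|x y /asboolP[a ->] /asboolP[b ->]].
- by apply/asboolP; exists 0; rewrite mulr0.
- by apply/asboolP; exists (a + b); rewrite mulrDr.
by apply/asboolP; exists (b * a); rewrite mulrA.
Qed.

HB.instance Definition _ e :=
  GRing.isSubmodClosed.Build A^c A^c^o (eA e) (eA_closed e).

Definition eA_mod (e : A) : lmodType A^c :=
  submod_type (GRing.SubmodClosed.clone A^c A^c^o (eA e) _).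

(* The submodule e rad A of eA. *)
Definition e_rad (e : A) : pred (eA_mod e) := fun x =>
  `[< exists2 r : A, r \in graded_rad & val x = e * r >].

Lemma e_rad_closed e : subsemimod_closed (@e_rad e).
Proof.
split=> [|a x /asboolP[r rr xE]].
  split=> [|x y /asboolP[r rr xE] /asboolP[s ss yE]]; apply/asboolP.
    by exists 0; rewrite ?graded_rad0 ?mulr0.
  by exists (r + s); rewrite ?graded_radD // mulrDr -xE -yE.
apply/asboolP; exists (r * a); first exact: graded_radM.
by rewrite mulrA -xE.
Qed.

HB.instance Definition _ e :=
  GRing.isSubmodClosed.Build A^c (eA_mod e) (@e_rad e) (e_rad_closed e).

Definition S_mod (e : A) : lmodType A^c :=
  quotmod (GRing.SubmodClosed.clone A^c (eA_mod e) (@e_rad e) _).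

End PositivelyGraded.

Section Idempotents.
Variable R : pzRingType.

Record idem_elt := IdemElt {
  idem_val :> R;
  idem_mul : idem_val * idem_val = idem_val
}.

Definition primitive (e : R) : Prop :=
  e != 0 /\
  forall f g : R, f * f = f -> g * g = g -> f * g = 0 -> g * f = 0 ->
    e = f + g -> f = 0 \/ g = 0.

Lemma idem_compl_subproof (e : idem_elt) :
  (1 - idem_val e) * (1 - idem_val e) = 1 - idem_val e.
Proof. by rewrite mulrBl mul1r mulrBr mulr1 idem_mul subrr subr0. Qed.

Definition idem_compl (e : idem_elt) : idem_elt :=
  IdemElt (idem_compl_subproof e).

(* The ring fRf, whose unit is f; it is the zero ring if f = 0. *)
Section Corner.
Variable f : idem_elt.

Definition corner_pred : pred R := fun x => `[< exists a, x = idem_val f * a * idem_val f >].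

Lemma corner_pred_closed : zmod_closed corner_pred.
Proof.
split=> [|x y /asboolP[a ->] /asboolP[b ->]]; apply/asboolP.
  by exists 0; rewrite mulr0 mul0r.
by exists (a - b); rewrite mulrBr mulrBl.
Qed.

HB.instance Definition _ :=
  GRing.isZmodClosed.Build R corner_pred corner_pred_closed.

Definition corner : Type := {x : R | x \in corner_pred}.
HB.instance Definition _ := [isSub of corner for @sval R _].
HB.instance Definition _ := [Choice of corner by <:].
HB.instance Definition _ := [SubChoice_isSubZmodule of corner by <:].

Lemma corner_valK (x : corner) : 
  (idem_val f * val x = val x) * (val x * idem_val f = val x).
Proof.
by have /asboolP[a ->] := valP x; rewrite !mulrA idem_mul -!mulrA idem_mul.
Qed.

Lemma corner_one_subproof : (f : R) \in corner_pred.
Proof. by apply/asboolP; exists 1; rewrite mulr1 idem_mul. Qed.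

Lemma corner_mul_subproof (x y : corner) : val x * val y \in corner_pred.
Proof.
apply/asboolP; exists (val x * val y).
by rewrite mulrA corner_valK -mulrA corner_valK.
Qed.

Definition corner_one : corner := Sub (f : R) corner_one_subproof.
Definition corner_mul (x y : corner) : corner :=
  Sub (val x * val y) (corner_mul_subproof x y).

Lemma corner_mulA : associative corner_mul.
Proof. by move=> x y z; apply: val_inj; rewrite /= mulrA. Qed.
Lemma corner_mul1l : left_id corner_one corner_mul.
Proof. by move=> x; apply: val_inj; rewrite /= corner_valK. Qed.
Lemma corner_mul1r : right_id corner_one corner_mul.
Proof. by move=> x; apply: val_inj; rewrite /= corner_valK. Qed.
Lemma corner_mulDl : left_distributive corner_mul +%R.
Proof. by move=> x y z; apply: val_inj; rewrite /= mulrDl. Qed.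
Lemma corner_mulDr : right_distributive corner_mul +%R.
Proof. by move=> x y z; apply: val_inj; rewrite /= mulrDr. Qed.

HB.instance Definition _ := GRing.Zmodule_isPzRing.Build corner
  corner_mulA corner_mul1l corner_mul1r corner_mulDl corner_mulDr.

End Corner.
End Idempotents.

(* Main.v *)
From HB Require Import structures.
Require Import Defs.
From mathcomp Require Import all_boot all_algebra generic_quotient ring_quotient.
From mathcomp Require Import boolp classical_sets functions.
Set Implicit Arguments.
Unset Strict Implicit.
Unset Printing Implicit Defensive.
Import GRing.Theory.
Local Open Scope ring_scope.
Local Open Scope quotient_scope.

(** Write f = 1 - e and S = S_e.

    A graded part comes first: since Ext^1(S, S) = 0 there are no loops at e,
    that is e A_1 = e A_1 f ([gr1_no_loop]), so e rad A = e A f A and S is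
    eA modulo the submodule generated by (eA)f.  Hence the modules M with
    Mf = 0 are exactly the direct sums of copies of S ([S_univ],
    [isotypic_dsum]); call them killed.

    For a module Z let B = Z f A be its trace and H = Z / B, which is killed.
    The trace is covered by a direct sum C of copies of fA, a projective module
    with Hom(C, S) = 0; let Z' be the kernel of C -> B.  Starting from Z = eA
    and iterating gives a complex of projectives whose homology modules are the
    killed modules H.  Multiplication by f turns this complex into a projective
    resolution of eAf over Gamma = fAf; as Gamma has finite global dimension,
    some Zf is projective over Gamma, and then the cover of B can be cut down
    to a direct summand for which Z' is itself killed ([tower_fix_projective]).
    So eA carries a finite tower of such steps ([tower_ex]).

    Suppose n > 0 and Ext^j(S, S) = 0 for all j > n; this holds for large n
    because A has finite global dimension.  Going up the tower, dimension
    shifting gives Ext^j(Z, S) = 0 for j >= n and every Z in the tower.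
    Going down from the top, either some H is nonzero and satisfies
    Ext^n(H, S) = 0, and then Ext^n(S, S) = 0 because S embeds in H, or all the
    H vanish and so do all the Ext^j(Z, S), which is absurd for Z = eA since
    Hom(eA, S) is nonzero ([tower_extv]).  Descending induction on n concludes.

    Vanishing of Ext is handled by a predicate [extv] that does not depend on
    the choice of projective presentations ([extvSS]) and obeys the long exact
    sequence in its first argument ([extv_les]); it agrees with the vanishing
    of [Ext] by [Ext_extv]. *)

(** * Linear maps, exact sequences and Ext^1 *)

Section LinearMaps.
Variable R : pzRingType.
Implicit Types K X Y Z P Q L M N : lmodType R.

Lemma linear_ex X Y (f : X -> Y) :
  (forall a x y, f (a *: x + y) = a *: f x + f y) ->
  exists g : {linear X -> Y}, forall x, g x = f x.
Proof.
move=> fl.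
pose g : {linear X -> Y} := HB.pack f (GRing.isLinear.Build R X Y *:%R f fl).
by exists g.
Qed.

(** Submodules, kernels and quotients are handed out as an unspecified module with
    an injective, respectively surjective, linear map. *)
Lemma submod_ex X (P : X -> Prop) :
  P 0 -> (forall a x y, P x -> P y -> P (a *: x + y)) ->
  exists (K : lmodType R) (i : {linear K -> X}),
    injective i /\ forall x, P x <-> exists y, x = i y.
Proof.
move=> P0 PD.
pose p : pred X := fun x => `[< P x >].
have pc : subsemimod_closed p.
  split=> [|a x /asboolP Px]; last first.
    by apply/asboolP; rewrite -[a *: x]addr0; apply: PD.
  split=> [|x y /asboolP Px /asboolP Py]; apply/asboolP => //.
  by rewrite -[x]scale1r; apply: PD.
pose S : submodClosed X := HB.pack p (GRing.isSubmodClosed.Build R X p pc).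
exists (submod_type S), (val : submod_type S -> X); split; first exact: val_inj.
move=> x; split=> [Px | [y ->]]; last by apply/asboolP/(valP y).
have Sx : x \in S by apply/asboolP.
by exists (Sub x Sx).
Qed.

Lemma quotmod_piP X (S : submodClosed X) (x : X) :
  \pi_(quotmod S) x = 0 <-> x \in S.
Proof.
rewrite -[0](raddf0 \pi_(quotmod S)).
split=> [/eqP|Sx]; first by rewrite -[_ == _]Quotient.idealrBE subr0.
by apply/eqP; rewrite -[_ == _]Quotient.idealrBE subr0.
Qed.

Lemma quot_ex X (P : X -> Prop) :
  P 0 -> (forall a x y, P x -> P y -> P (a *: x + y)) ->
  exists (Q : lmodType R) (p : {linear X -> Q}),
    (forall y, exists x, p x = y) /\ forall x, p x = 0 <-> P x.
Proof.
move=> P0 PD.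
pose q : pred X := fun x => `[< P x >].
have qc : subsemimod_closed q.
  split=> [|a x /asboolP Px]; last first.
    by apply/asboolP; rewrite -[a *: x]addr0; apply: PD.
  split=> [|x y /asboolP Px /asboolP Py]; apply/asboolP => //.
  by rewrite -[x]scale1r; apply: PD.
pose S : submodClosed X := HB.pack q (GRing.isSubmodClosed.Build R X q qc).
have [|p pE] := @linear_ex X (quotmod S) (\pi_(quotmod S)).
  by move=> a x y; rewrite raddfD; congr (_ + _); apply/esym/quotmod_scale_pi.
exists (quotmod S), p; split=> [|x]; first by elim/quotW=> x; exists x.
rewrite pE quotmod_piP; split=> [/asboolP //|Px]; exact/asboolP.
Qed.

(** Short exact sequences 0 -> K -> X -> M -> 0. *)
Definition ses K X M (i : {linear K -> X}) (p : {linear X -> M}) : Prop :=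
  [/\ injective i, forall y, exists x, p x = y
    & forall x, p x = 0 <-> exists y, x = i y].

Lemma ker_ex X M (p : {linear X -> M}) : (forall y, exists x, p x = y) ->
  exists (K : lmodType R) (i : {linear K -> X}), ses i p.
Proof.
move=> ps; have [||K [i [ii iE]]] := @submod_ex X (fun x => p x = 0).
- exact: linear0.
- by move=> a x y x0 y0; rewrite linearP x0 y0 scaler0 addr0.
by exists K, i.
Qed.

(** A linear map that vanishes on the kernel of a surjection factors through it. *)
Lemma factor_surj X Y N (p : {linear X -> Y}) (g : {linear X -> N}) :
  (forall y, exists x, p x = y) -> (forall x, p x = 0 -> g x = 0) ->
  exists h : {linear Y -> N}, forall x, h (p x) = g x.
Proof.
move=> ps pg; have pg' x y : p x = p y -> g x = g y.
  move=> pxy; apply/eqP; rewrite -subr_eq0 -linearB; apply/eqP/pg.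
  by rewrite linearB pxy subrr.
pose s y := projT1 (cid (ps y)); have sE y : p (s y) = y by rewrite /s; case: cid.
have [|h hE] := @linear_ex Y N (g \o s).
  by move=> a x y /=; rewrite -linearP; apply: pg'; rewrite linearP !sE.
by exists h => x; rewrite hE /=; apply: pg'.
Qed.

(** A linear map whose image lies in that of an injection factors through it. *)
Lemma factor_inj K X Y (i : {linear K -> X}) (g : {linear Y -> X}) :
  injective i -> (forall y, exists x, g y = i x) ->
  exists h : {linear Y -> K}, forall y, i (h y) = g y.
Proof.
move=> ii gi; pose s y := projT1 (cid (gi y)).
have sE y : i (s y) = g y by rewrite /s; case: cid.
have [|h hE] := @linear_ex Y K s.
  by move=> a x y; apply: ii; rewrite linearP !sE linearP.
by exists h => y; rewrite hE.
Qed.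

(** The pullback of [g] and [p]; the last clause says that its two projections are
    jointly injective. *)
Lemma pullback_ex X P M (g : {linear X -> M}) (p : {linear P -> M}) :
  exists (Z : lmodType R) (a : {linear Z -> X}) (b : {linear Z -> P}),
  [/\ forall z, g (a z) = p (b z),
      forall x y, g x = p y -> exists z, a z = x /\ b z = y
    & forall z, a z = 0 -> b z = 0 -> z = 0].
Proof.
have [||Z [i [ii iE]]] := @submod_ex (X * P)%type (fun u => g u.1 = p u.2).
- by rewrite !linear0.
- by move=> c x y xE yE; rewrite !linearP xE yE.
have [|a aE] := @linear_ex Z X (fun z => (i z).1).
  by move=> c x y; rewrite linearP.
have [|b bE] := @linear_ex Z P (fun z => (i z).2).
  by move=> c x y; rewrite linearP.
exists Z, a, b; split=> [z|x y xy|z az bz].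
- by rewrite aE bE; apply/iE; exists z.
- have /iE[z zE] : g (x, y).1 = p (x, y).2 by [].
  by exists z; rewrite aE bE -zE.
apply: ii; rewrite linear0 [i z]surjective_pairing -aE -bE az bz.
by [].
Qed.

(** Ext^1(M, N) = 0, in the form: along every extension of M by K, projective or
    not, every map K -> N extends to the middle term.  This avoids any choice of
    presentation of M. *)
Definition ext1 M N : Prop :=
  forall K X (i : {linear K -> X}) (p : {linear X -> M}), ses i p ->
  forall f : {linear K -> N}, exists g : {linear X -> N}, forall x, g (i x) = f x.

(** It is enough to extend maps along one projective presentation. *)
Lemma ext1_presentation K P M N (i : {linear K -> P}) (p : {linear P -> M}) :
  ses i p -> projective P ->
  (forall f : {linear K -> N},
     exists g : {linear P -> N}, forall x, g (i x) = f x) ->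
  ext1 M N.
Proof.
move=> [ii ps ip] projP ext K' X i' p' [ii' ps' ip'] f.
have [t tE] := projP _ _ _ p ps'.
have [|t0 t0E] := @factor_inj _ _ _ i' (t \o i) ii'.
  by move=> y /=; apply/ip'; rewrite tE; apply/ip; exists y.
have [h hE] := ext (f \o t0).
have [|q qE] := @linear_ex (K' * P)%type X (fun u => i' u.1 + t u.2).
  by move=> a [x y] [x' y'] /=; rewrite !linearP scalerDr addrACA.
have [|r rE] := @linear_ex (K' * P)%type N (fun u => f u.1 + h u.2).
  by move=> a [x y] [x' y'] /=; rewrite !linearP scalerDr addrACA.
have [||g gE] := @factor_surj _ _ _ q r.
- move=> x; have [y yE] := ps (p' x).
  have /ip'[k kE] : p' (x - t y) = 0 by rewrite linearB tE yE subrr.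
  by exists (k, y); rewrite qE /= -kE subrK.
- move=> [k y]; rewrite qE rE /= => ky0.
  have /ip[z zE] : p y = 0.
    have pk : p' (i' k) = 0 by apply/ip'; exists k.
    by rewrite -tE -(addr0_eq ky0) linearN pk oppr0.
  have -> : k = - t0 z.
    by apply: ii'; rewrite linearN t0E /= -zE; apply/eqP; rewrite -addr_eq0 ky0.
  by rewrite zE hE linearN addNr.
exists g => x; have := gE (x, 0); rewrite qE rE /= !linear0 !addr0.
by [].
Qed.

End LinearMaps.

(** * Direct sums *)

Section DirectSums.
Variable R : pzRingType.
Implicit Types K M N P : lmodType R.

(** A direct sum of copies of K indexed by I, described by its injections and
    projections; every element is the sum of finitely many of its components. *)
Record direct_sum (I : choiceType) K := DirectSum {
  ds_mod :> lmodType R;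
  ds_in : I -> {linear K -> ds_mod};
  ds_pr : I -> {linear ds_mod -> K};
  ds_prE : forall i j x, ds_pr j (ds_in i x) = if i == j then x else 0;
  ds_fin : forall d, exists2 s : seq I, uniq s & d = \sum_(i <- s) ds_in i (ds_pr i d)
}.

(** Direct sums exist: take the functions I -> K with finite support. *)
Lemma direct_sum_ex (I : choiceType) K : exists D : direct_sum I K, True.
Proof.
pose fs (g : I -> K) := exists s : seq I, forall i, i \notin s -> g i = 0.
have [||D [v [vi vE]]] := @submod_ex R (I -> K) fs.
- by exists [::].
- move=> a g h [s sg] [t th]; exists (s ++ t) => i.
  rewrite mem_cat negb_or => /andP[/sg gi /th hi].
  by rewrite /= -[LHS]/(a *: g i + h i) gi hi scaler0 addr0.
have prl i : exists pi : {linear D -> K}, forall x, pi x = v x i.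
  by apply: linear_ex => a x y; rewrite linearP.
pose pr i := projT1 (cid (prl i)).
have prE i x : pr i x = v x i by rewrite /pr; case: cid.
have inl i : exists f : {linear K -> D},
    forall x, v (f x) = fun j => if i == j then x else 0.
  have [|f fE] := @linear_ex R K (I -> K) (fun x j => if i == j then x else 0).
    move=> a x y; apply/funext => j.
    rewrite -[RHS]/(a *: (if i == j then x else 0) + (if i == j then y else 0)).
    by case: ifP; rewrite // scaler0 addr0.
  have [|g gE] := @factor_inj _ _ _ _ v f vi.
    by move=> x; apply/vE; exists [:: i] => j; rewrite inE eq_sym fE => /negPf->.
  by exists g => x; rewrite gE fE.
pose ini i := projT1 (cid (inl i)).
have inE i x : v (ini i x) = fun j => if i == j then x else 0.
  by rewrite /ini; case: cid.
have prin i j x : pr j (ini i x) = if i == j then x else 0 by rewrite prE inE.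
suff fin d : exists2 s : seq I, uniq s & d = \sum_(i <- s) ini i (pr i d).
  by exists (DirectSum prin fin).
have /vE[s sd] : exists y, v d = v y by exists d.
exists (undup s); first exact: undup_uniq.
apply: vi; apply/funext => j; rewrite linear_sum fct_sumE.
under eq_bigr do rewrite inE prE.
have [js|js] := boolP (j \in undup s).
  rewrite (bigD1_seq j) ?undup_uniq //= eqxx big1 ?addr0 // => i.
  by move/negPf->.
rewrite big1_seq; first by apply: sd; rewrite -mem_undup.
move=> i /andP[_ is_].
by case: eqP => // ij; rewrite -ij is_ in js.
Qed.

Definition dsum (I : choiceType) K : direct_sum I K :=
  projT1 (cid (direct_sum_ex I K)).

Section Theory.
Variables (I : choiceType) (K : lmodType R) (D : direct_sum I K).
Local Notation ini := (ds_in D).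
Local Notation pr := (ds_pr D).

Lemma ds_eq d d' : (forall i, pr i d = pr i d') -> d = d'.
Proof.
move=> dd'; apply/eqP; rewrite -subr_eq0; apply/eqP.
have [s _ ->] := ds_fin (d - d').
by apply: big1 => i _; rewrite linearB dd' subrr linear0.
Qed.

Lemma ds_ext N (f g : {linear D -> N}) :
  (forall i x, f (ini i x) = g (ini i x)) -> forall d, f d = g d.
Proof.
move=> fg d; have [s _ ->] := ds_fin d; rewrite !linear_sum.
by apply: eq_bigr => i _; rewrite fg.
Qed.

(** The universal property of the direct sum. *)
Lemma ds_lift N (h : I -> {linear K -> N}) :
  exists g : {linear D -> N}, forall i x, g (ini i x) = h i x.
Proof.
pose s (d : D) := projT1 (cid2 (ds_fin d)).
have su d : uniq (s d) by rewrite /s; case: cid2.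
have sE d i : i \notin s d -> pr i d = 0.
  rewrite /s; case: cid2 => t ut dE /= it; rewrite dE linear_sum big1_seq // => j.
  by case/andP=> _ jt; rewrite ds_prE; case: eqP => // ji; rewrite -ji jt in it.
pose G d := \sum_(i <- s d) h i (pr i d).
have GE d t : uniq t -> {subset s d <= t} -> G d = \sum_(i <- t) h i (pr i d).
  move=> ut st; rewrite (bigID (mem (s d)) predT) /=.
  rewrite [X in _ + X]big1 ?addr0 => [|i si]; last by rewrite sE ?linear0.
  rewrite -big_filter; apply: perm_big; apply: uniq_perm => // [|i].
    exact: filter_uniq.
  by rewrite mem_filter; case: (boolP (i \in s d)) => //= /st ->.
have [|g gE] := @linear_ex R D N G.
  move=> a x y; pose t := undup (s (a *: x + y) ++ (s x ++ s y)).
  have ut : uniq t by apply: undup_uniq.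
  have tE i : (i \in t) = (i \in s (a *: x + y)) || (i \in s x) || (i \in s y).
    by rewrite mem_undup !mem_cat orbA.
  rewrite (GE _ t) // => [|i si]; last by rewrite tE si.
  rewrite (GE x t) // => [|i si]; last by rewrite tE si orbT.
  rewrite (GE y t) // => [|i si]; last by rewrite tE si !orbT.
  by rewrite scaler_sumr -big_split; apply: eq_bigr => i _; rewrite !linearP.
exists g => i x; rewrite gE.
have -> : G (ini i x) = \sum_(j <- [:: i]) h j (pr j (ini i x)).
  rewrite (GE _ (undup (i :: s (ini i x)))) ?undup_uniq //; last first.
    by move=> j js; rewrite mem_undup inE js orbT.
  rewrite (bigD1_seq i) ?undup_uniq ?mem_undup ?mem_head //= big_seq1.
  by rewrite big1 ?addr0 // => j ji; rewrite ds_prE eq_sym (negPf ji) linear0.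
by rewrite big_seq1 ds_prE eqxx.
Qed.

Lemma dsum_projective : projective K -> projective D.
Proof.
move=> projK M N g f gs.
have ex i := projK M N g (f \o ini i) gs.
have [h hE] := ds_lift (fun i => projT1 (cid (ex i))).
exists h; apply: (ds_ext (f := g \o h)) => i x /=.
by rewrite hE; case: cid => /= u ->.
Qed.

End Theory.

Lemma regular_projective : projective R^o.
Proof.
move=> M N g f gs; have [x xE] := gs (f 1).
have [|h hE] := @linear_ex R R^o M (fun a => (a : R) *: x).
  by move=> a b c; rewrite scalerDl scalerA.
exists h => a; rewrite hE linearZ /= xE -linearZ; congr (f _); exact: mulr1.
Qed.

Lemma enough_projectives M : exists (K P : lmodType R) (i : {linear K -> P})
  (p : {linear P -> M}), ses i p /\ projective P.
Proof.
pose D := dsum M R^o.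
have ex (x : M) : exists h : {linear R^o -> M}, forall a, h a = (a : R) *: x.
  by apply: linear_ex => a b c; rewrite scalerDl scalerA.
have [p pE] := ds_lift D (fun x => projT1 (cid (ex x))).
have [|K [i ip]] := @ker_ex _ _ _ p.
  move=> x; exists (ds_in D x (1 : R)); rewrite pE.
  by case: cid => h /= ->; rewrite scale1r.
by exists K, D, i, p; split=> //; apply/dsum_projective/regular_projective.
Qed.

End DirectSums.

(** * Vanishing of Ext *)

Section Ext.
Variable R : pzRingType.
Implicit Types B F H K L M N P Q X Y Z : lmodType R.

Lemma projective_retract P Q (a : {linear Q -> P}) (b : {linear P -> Q}) :
  (forall x, b (a x) = x) -> projective P -> projective Q.
Proof.
move=> ba projP M N g f gs; have [h hE] := projP M N g (f \o b) gs.
by exists (h \o a) => x /=; rewrite hE /= ba.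
Qed.

Lemma ses_split K X P (i : {linear K -> X}) (p : {linear X -> P}) :
  ses i p -> projective P ->
  exists r : {linear X -> K}, forall x, r (i x) = x.
Proof.
move=> [ii ps ip] projP; have [s sE] := projP _ _ p idfun ps.
have [|q qE] := @linear_ex R X X (fun x => x - s (p x)).
  by move=> a x y; rewrite !linearP scalerDr addrACA.
have [|r rE] := @factor_inj _ _ _ _ i q ii.
  by move=> x; apply/ip; rewrite qE linearB sE subrr.
exists r => x; apply: ii; rewrite rE qE.
have -> : p (i x) = 0 by apply/ip; exists x.
by rewrite linear0 subr0.
Qed.

Lemma ses_kernel_projective L F P (i : {linear L -> F}) (p : {linear F -> P}) :
  ses i p -> projective P -> projective F -> projective L.
Proof.
by move=> ip projP; have [r rE] := ses_split ip projP; apply: projective_retract.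
Qed.

(** The pullback of an extension of M along a map Z -> M is an extension of Z by
    the same kernel. *)
Lemma pullback_ses K X M Z (i : {linear K -> X}) (p : {linear X -> M})
    (g : {linear Z -> M}) : ses i p ->
  exists (Y : lmodType R) (a : {linear Y -> X}) (b : {linear Y -> Z})
    (j : {linear K -> Y}),
  [/\ ses j b, forall k, a (j k) = i k, forall y, p (a y) = g (b y),
      forall x z, p x = g z -> exists y, a y = x /\ b y = z
    & forall y, a y = 0 -> b y = 0 -> y = 0].
Proof.
move=> [ii ps ip]; have [Y [a [b [ab abex abinj]]]] := pullback_ex p g.
have jex k : exists y, a y = i k /\ b y = 0.
  by apply: abex; rewrite linear0; apply/ip; exists k.
pose j0 k := projT1 (cid (jex k)).
have [j0a j0b] : (forall k, a (j0 k) = i k) /\ (forall k, b (j0 k) = 0).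
  by split=> k; rewrite /j0; case: cid => ? [].
have [|j jE] := @linear_ex R K Y j0.
  move=> c x y; apply/eqP; rewrite -subr_eq0; apply/eqP; apply: abinj.
    by rewrite linearB linearP !j0a linearP subrr.
  by rewrite linearB linearP !j0b scaler0 addr0 subrr.
exists Y, a, b, j; split=> // [|k]; last by rewrite jE j0a.
split=> [x y xy|z|y].
- by apply: ii; rewrite -!j0a -!jE xy.
- have [x xE] := ps (g z); have [y [_ yE]] := abex _ _ xE.
  by exists y.
split=> [by0|[k ->]]; last by rewrite jE j0b.
have /ip[k kE] : p (a y) = 0 by rewrite ab by0 linear0.
exists k; apply/eqP; rewrite -subr_eq0; apply/eqP; apply: abinj.
  by rewrite linearB jE j0a kE subrr.
by rewrite linearB by0 jE j0b subrr.
Qed.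

(** The pullback of two surjections onto M carries two exact sequences, as in
    Schanuel's lemma. *)
Lemma pullback2_ses K X M K' Z (i : {linear K -> X}) (p : {linear X -> M})
    (i' : {linear K' -> Z}) (g : {linear Z -> M}) : ses i p -> ses i' g ->
  exists (Y : lmodType R) (a : {linear Y -> X}) (b : {linear Y -> Z})
    (j : {linear K -> Y}) (j' : {linear K' -> Y}),
  [/\ ses j b, ses j' a, forall k, a (j k) = i k, forall k, b (j' k) = i' k
    & forall y, p (a y) = g (b y)].
Proof.
move=> ip [ii' gs ig'].
have [Y [a [b [j [jb aj ab abex abinj]]]]] := pullback_ses g ip.
(* The map K' -> Y into the pullback that is zero on the other side. *)
have jex k : exists y, a y = 0 /\ b y = i' k.
  by apply: abex; rewrite linear0; apply/esym/ig'; exists k.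
pose j0 k := projT1 (cid (jex k)).
have [j0a j0b] : (forall k, a (j0 k) = 0) /\ (forall k, b (j0 k) = i' k).
  by split=> k; rewrite /j0; case: cid => ? [].
have [|j' jE] := @linear_ex R K' Y j0.
  move=> c x y; apply/eqP; rewrite -subr_eq0; apply/eqP; apply: abinj.
    by rewrite linearB linearP !j0a scaler0 addr0 subrr.
  by rewrite linearB linearP !j0b linearP subrr.
exists Y, a, b, j, j'; split=> // [|k]; last by rewrite jE j0b.
split=> [x y xy|z|y].
- by apply: ii'; rewrite -!j0b -!jE xy.
- have [x xE] := gs (p z); have [y [yE _]] := abex _ _ (esym xE).
  by exists y.
split=> [ay0|[k ->]]; last by rewrite jE j0a.
have /ig'[k kE] : g (b y) = 0 by rewrite -ab ay0 linear0.
exists k; apply/eqP; rewrite -subr_eq0; apply/eqP; apply: abinj.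
  by rewrite linearB jE j0a ay0 subrr.
by rewrite linearB kE jE j0b subrr.
Qed.

(** Given 0 -> B -> Z -> H -> 0 and a presentation 0 -> K -> P -> Z -> 0, the kernel
    L of P -> H presents H, and 0 -> K -> L -> B -> 0 is exact.  This rotation
    shifts the long exact sequence by one step. *)
Lemma rotate_ses B Z H K P (i : {linear B -> Z}) (p : {linear Z -> H})
    (k : {linear K -> P}) (q : {linear P -> Z}) : ses i p -> ses k q ->
  exists (L : lmodType R) (l : {linear L -> P}) (u : {linear K -> L})
    (v : {linear L -> B}),
  [/\ ses l (p \o q), ses u v & forall x, l (u x) = k x].
Proof.
move=> [ii ps ip] [ki qs kq].
have [|L [l lpq]] := @ker_ex _ _ _ (p \o q).
  by move=> y; have [x <-] := ps y; have [z <-] := qs x; exists z.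
have [li _ lE] := lpq.
have [|u uE] := @factor_inj _ _ _ _ l k li.
  move=> y; apply/lE => /=; have -> : q (k y) = 0 by apply/kq; exists y.
  exact: linear0.
have [|v vE] := @factor_inj _ _ _ _ i (q \o l) ii.
  by move=> y /=; apply/ip; apply/lE; exists y.
exists L, l, u, v; split=> //; split=> [x y xy|y|x].
- by apply: ki; rewrite -!uE xy.
- have [x xE] := qs (i y).
  have /lE[z zE] : (p \o q) x = 0 by rewrite /= xE; apply/ip; exists y.
  by exists z; apply: ii; rewrite vE /= -zE.
split=> [vx0|[y ->]].
  have /kq[y yE] : q (l x) = 0 by rewrite -[LHS]/((q \o l) x) -vE vx0 linear0.
  by exists y; apply: li; rewrite uE.
by apply: ii; rewrite vE /= uE linear0; apply/kq; exists y.
Qed.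

Lemma ext1_projective P N : projective P -> ext1 P N.
Proof.
move=> projP K X i p ip f; have [r rE] := ses_split ip projP.
by exists (f \o r) => x /=; rewrite rE.
Qed.

Lemma ext1_retract K X N (a : {linear K -> X}) (r : {linear X -> K}) :
  (forall x, r (a x) = x) -> ext1 X N -> ext1 K N.
Proof.
move=> ra extX K' Y i q iq f.
have [W [c [b [j [jb cj cb cbex cbinj]]]]] := pullback_ses r iq.
have [g gE] := extX _ _ _ _ jb f.
have hex y : exists w, c w = y /\ b w = a (q y) by apply: cbex; rewrite ra.
pose h0 y := projT1 (cid (hex y)).
have [hc hb] : (forall y, c (h0 y) = y) /\ (forall y, b (h0 y) = a (q y)).
  by split=> k; rewrite /h0; case: cid => ? [].
have [|h hE] := @linear_ex R Y W h0.
  move=> e x y; apply/eqP; rewrite -subr_eq0; apply/eqP; apply: cbinj.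
    by rewrite linearB linearP !hc subrr.
  by rewrite linearB linearP !hb (linearP q) (linearP a) subrr.
exists (g \o h) => x /=; rewrite -gE; congr (g _).
have [ii _ iqE] := iq; have [_ _ jbE] := jb.
apply/eqP; rewrite -subr_eq0; apply/eqP; apply: cbinj.
  by rewrite linearB cj hE hc subrr.
rewrite linearB hE hb; have -> : q (i x) = 0 by apply/iqE; exists x.
by rewrite linear0 sub0r (_ : b _ = 0) ?oppr0 //; apply/jbE; exists x.
Qed.

(** The exactness of Hom(L, N) -> Hom(K, N) -> Ext^1(B, N) -> Ext^1(L, N). *)
Lemma ext1_quotient K L B N (k : {linear K -> L}) (v : {linear L -> B}) :
  ses k v -> ext1 L N ->
  (forall f : {linear K -> N},
     exists g : {linear L -> N}, forall x, g (k x) = f x) ->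
  ext1 B N.
Proof.
move=> kv extL extK K' X i p ip f.
have [Y [a [b [j [j' [jb ja aj bj ab]]]]]] := pullback2_ses ip kv.
have [g gE] := extL _ _ _ _ jb f.
have [u uE] := extK (g \o j').
have [_ as_ aE] := ja; have [_ _ bE] := jb.
have [|w wE] := @linear_ex R Y N (fun y => g y - u (b y)).
  by move=> e x y; rewrite !linearP scalerDr addrACA.
have [|h hE] := @factor_surj _ _ _ _ a w as_.
  by move=> y /aE[x ->]; rewrite wE bj uE subrr.
exists h => x; rewrite -aj hE wE gE.
have -> : b (j x) = 0 by apply/bE; exists x.
by rewrite linear0 subr0.
Qed.

Lemma ext1_extension B Z H N (i : {linear B -> Z}) (p : {linear Z -> H}) :
  ses i p -> ext1 B N -> ext1 H N -> ext1 Z N.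
Proof.
move=> ip extB extH K X k q kq f.
have [L [l [u [v [lpq uv luk]]]]] := rotate_ses ip kq.
have [g gE] := extB _ _ _ _ uv f; have [h hE] := extH _ _ _ _ lpq g.
by exists h => x; rewrite -luk hE.
Qed.

(** Ext^j(M, N) = 0, by dimension shifting from degree 1.  In degree j > 1 some
    projective presentation of M is used; [extvSS] shows that any other would do. *)
Fixpoint extv (j : nat) M N : Prop :=
  match j with
  | 0 => forall (f : {linear M -> N}) x, f x = 0
  | j'.+1 => if j' is 0 then ext1 M N else
      exists (K P : lmodType R) (i : {linear K -> P}) (p : {linear P -> M}),
        [/\ ses i p, projective P & extv j' K N]
  end.

(** A projective direct summand does not change the vanishing of Ext in positive
    degrees.  The induction uses that, by Schanuel's lemma, the statement in a given
    degree makes the next degree independent of the chosen presentation. *)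
Lemma extv_split N j : forall K X P (i : {linear K -> X}) (p : {linear X -> P}),
  ses i p -> projective P -> extv j.+1 X N <-> extv j.+1 K N.
Proof.
have schanuel j' : (forall K X P (i : {linear K -> X}) (p : {linear X -> P}),
    ses i p -> projective P -> extv j'.+1 X N <-> extv j'.+1 K N) ->
  forall M K P (i : {linear K -> P}) (p : {linear P -> M})
           K' P' (i' : {linear K' -> P'}) (p' : {linear P' -> M}),
    ses i p -> projective P -> ses i' p' -> projective P' ->
    extv j'.+1 K N -> extv j'.+1 K' N.
  move=> S M K P i p K' P' i' p' ip projP ip' projP' extK.
  have [Y [a [b [j1 [j2 [jb ja _ _ _]]]]]] := pullback2_ses ip ip'.
  by apply/(S _ _ _ _ _ ja projP)/(S _ _ _ _ _ jb projP').
elim: j => [|j IH] K X P i p ip projP.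
  split=> extX; last by apply: ext1_extension ip _ (ext1_projective projP).
  by have [r rE] := ses_split ip projP; apply: ext1_retract rE extX.
split=> [[K2 [F [k [q [kq projF extK2]]]]]|extK].
  have [L [l [u [v [lpq uv _]]]]] := rotate_ses ip kq.
  by exists K2, L, u, v; split=> //; apply: ses_kernel_projective lpq _ _.
have [K2 [F [k [q [kq projF]]]]] := enough_projectives X.
exists K2, F, k, q; split=> //.
have [L [l [u [v [lpq uv _]]]]] := rotate_ses ip kq.
have projL : projective L by apply: ses_kernel_projective lpq _ _.
have [K3 [F3 [k3 [q3 [kq3 projF3 extK3]]]]] := extK.
exact: (schanuel _ IH _ _ _ _ _ _ _ _ _ kq3 projF3 uv projL).
Qed.

Lemma extvSS K P M N j (i : {linear K -> P}) (p : {linear P -> M}) :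
  ses i p -> projective P -> extv j.+2 M N <-> extv j.+1 K N.
Proof.
move=> ip projP; split=> [|extK]; last by exists K, P, i, p.
move=> [K' [P' [i' [p' [ip' projP' extK']]]]].
have [Y [a [b [j1 [j2 [jb ja _ _ _]]]]]] := pullback2_ses ip ip'.
by apply/(extv_split _ _ jb projP')/(extv_split _ _ ja projP).
Qed.

(** The three exactness statements of the long exact sequence of Ext(-, N).  The
    rotation [rotate_ses] turns the statement at B in degree j.+2 into the one at H
    in degree j.+1, the one at H into the one at Z, and the one at Z into the one
    at B one degree lower. *)
Lemma extv_les N j : forall B Z H (i : {linear B -> Z}) (p : {linear Z -> H}),
  ses i p ->
  [/\ extv j Z N -> extv j.+1 H N -> extv j B N,
      extv j.+1 B N -> extv j.+1 H N -> extv j.+1 Z N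
    & extv j B N -> extv j.+1 Z N -> extv j.+1 H N].
Proof.
have A0 B Z H (i : {linear B -> Z}) (p : {linear Z -> H}) :
    ses i p -> extv 0 Z N -> extv 1 H N -> extv 0 B N.
  move=> ip extZ extH f x; have [g <-] := extH _ _ _ _ ip f.
  exact: extZ.
have A1 B Z H (i : {linear B -> Z}) (p : {linear Z -> H}) :
    ses i p -> extv 1 Z N -> extv 2 H N -> extv 1 B N.
  move=> ip extZ extH; have [K [P [k [q [kq projP]]]]] := enough_projectives Z.
  have [L [l [u [v [lpq uv luk]]]]] := rotate_ses ip kq.
  apply: (ext1_quotient uv) => [|f]; first exact: (extvSS N 0 lpq projP).1.
  have [g gE] := extZ _ _ _ _ kq f; exists (g \o l) => x /=.
  by rewrite luk gE.
have B0 B Z H (i : {linear B -> Z}) (p : {linear Z -> H}) :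
    ses i p -> extv 0 B N -> extv 1 Z N -> extv 1 H N.
  move=> ip extB extZ; apply: (ext1_quotient ip) => // f.
  by exists (\0 : {linear Z -> N}) => x; rewrite extB.
have BS j' : (forall B Z H (i : {linear B -> Z}) (p : {linear Z -> H}),
    ses i p -> extv j'.+1 B N -> extv j'.+1 H N -> extv j'.+1 Z N) ->
    forall B Z H (i : {linear B -> Z}) (p : {linear Z -> H}),
    ses i p -> extv j'.+1 B N -> extv j'.+2 Z N -> extv j'.+2 H N.
  move=> C B Z H i p ip extB extZ.
  have [K [P [k [q [kq projP]]]]] := enough_projectives Z.
  have [L [l [u [v [lpq uv luk]]]]] := rotate_ses ip kq.
  apply/(extvSS _ _ lpq projP) => //; apply: (C _ _ _ _ _ uv) => //.
  exact/(extvSS _ _ kq projP).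
suff AC j' : forall B Z H (i : {linear B -> Z}) (p : {linear Z -> H}),
    ses i p ->
    (extv j'.+1 Z N -> extv j'.+2 H N -> extv j'.+1 B N) /\
    (extv j'.+1 B N -> extv j'.+1 H N -> extv j'.+1 Z N).
  case: j => [|j] B Z H i p ip; split; first exact: A0 ip.
  - exact: (AC _ _ _ _ _ _ ip).2.
  - exact: B0 ip.
  - exact: (AC _ _ _ _ _ _ ip).1.
  - exact: (AC _ _ _ _ _ _ ip).2.
  apply: (BS j _ _ _ _ _ _ ip) => B' Z' H' i' p' ip'.
  exact: (AC _ _ _ _ _ _ ip').2.
elim: j' => [|j' IH] B Z H i p ip.
  by split; [apply: A1 ip | apply: ext1_extension ip].
have [K [P [k [q [kq projP]]]]] := enough_projectives Z.
have [L [l [u [v [lpq uv luk]]]]] := rotate_ses ip kq.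
have exL m : extv m.+2 H N <-> extv m.+1 L N := extvSS _ _ lpq projP.
have exK m : extv m.+2 Z N <-> extv m.+1 K N := extvSS _ _ kq projP.
split=> [/exK extK /exL extL|extB /exL extL].
  by apply: (BS _ _ _ _ _ _ _ uv) => // B' Z' H' i' p' /IH[].
by apply/exK; apply: (IH _ _ _ _ _ uv).1.
Qed.

Lemma extv_sub N j B Z H (i : {linear B -> Z}) (p : {linear Z -> H}) :
  ses i p -> extv j Z N -> extv j.+1 H N -> extv j B N.
Proof. by case/(extv_les N j). Qed.

Lemma extv_quot N j B Z H (i : {linear B -> Z}) (p : {linear Z -> H}) :
  ses i p -> extv j B N -> extv j.+1 Z N -> extv j.+1 H N.
Proof. by case/(extv_les N j). Qed.

End Ext.

(** * Projective dimension, direct sums and comparison with [Ext] *)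

Section Dimension.
Variable R : pzRingType.
Implicit Types B F H K L M N P Q S X Y Z : lmodType R.

Lemma extv_projective j P N : projective P -> extv j.+1 P N.
Proof.
elim: j P => [|j IH] P projP; first exact: ext1_projective.
have [|K [i ip]] := @ker_ex R P P idfun; first by move=> y; exists y.
by exists K, P, i, idfun; split=> //; apply/IH/(ses_kernel_projective ip).
Qed.

(** The kernel of the augmentation has the shifted resolution, which lowers the
    projective dimension by one. *)
Lemma pdim_le_extv n M N : pdim_le n M -> forall j, (n < j)%N -> extv j M N.
Proof.
elim: n M => [|n IH] M [P Ptriv] [|j] // nj.
  apply: extv_projective.
  have ai : injective (res_aug P).
    move=> x y xy; apply/eqP; rewrite -subr_eq0; apply/eqP.
    have /res_exact0[z ->] : res_aug P (x - y) = 0 by rewrite linearB xy subrr.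
    by rewrite (Ptriv 1%N isT z) linear0.
  have [|h hE] := @factor_inj _ _ _ _ (res_aug P) (@idfun M) ai.
    by move=> y; have [x xE] := res_aug_surj P y; exists x; rewrite xE.
  exact: (projective_retract hE (@res_proj _ _ P 0)).
case: j nj => // j nj.
have [K [i ip]] := ker_ex (res_aug_surj P); have [ii _ iE] := ip.
apply/(extvSS _ _ ip (@res_proj _ _ P 0)); apply: IH => //.
have [|a aE] := @factor_inj _ _ _ _ i (res_diff P 0) ii.
  by move=> y; apply/iE/res_exact0; exists y.
have as_ y : exists x, a x = y.
  have /res_exact0[x xE] : res_aug P (i y) = 0 by apply/iE; exists y.
  by exists x; apply: ii; rewrite aE xE.
have a0 x : a x = 0 <-> exists y, x = res_diff P 1 y.
  split=> [ax|/res_exactS x0]; first by apply/res_exactS; rewrite -aE ax linear0.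
  by apply: ii; rewrite aE linear0.
(* The resolution of the kernel K of the augmentation. *)
pose P' := {| res_diff := fun i => res_diff P i.+1;
  res_proj := fun i => @res_proj _ _ P i.+1; res_aug_surj := as_; res_exact0 := a0;
  res_exactS := fun i => @res_exactS _ _ P i.+1 |}.
by exists P' => m nm; apply: (Ptriv m.+1).
Qed.

Lemma ext1_all_projective M : (forall N, ext1 M N) -> projective M.
Proof.
move=> ext; have [K [P [i [p [ip projP]]]]] := enough_projectives M.
have [r rE] := ext _ _ _ _ _ ip (@idfun K); have [ii ps iE] := ip.
have [|q qE] := @linear_ex R P P (fun x => x - i (r x)).
  by move=> a x y; rewrite !linearP scalerDr addrACA.
have [|h hE] := factor_surj (g := q) ps.
  by move=> x /iE[y ->]; rewrite qE rE subrr.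
suff ph x : p (h x) = x by exact: (projective_retract ph projP).
have [y <-] := ps x; rewrite hE qE linearB.
have -> : p (i (r y)) = 0 by apply/iE; exists (r y).
by rewrite subr0.
Qed.

Lemma ses_dsum (I : choiceType) K P M (i : {linear K -> P}) (p : {linear P -> M}) :
  ses i p ->
  exists (i' : {linear dsum I K -> dsum I P}) (p' : {linear dsum I P -> dsum I M}),
  [/\ ses i' p', forall j x, i' (ds_in _ j x) = ds_in _ j (i x)
    & forall j x, p' (ds_in _ j x) = ds_in _ j (p x)].
Proof.
move=> [ii ps ip].
have [i' iE] := ds_lift (dsum I K) (fun j => ds_in (dsum I P) j \o i).
have [p' pE] := ds_lift (dsum I P) (fun j => ds_in (dsum I M) j \o p).
have pri j d : ds_pr (dsum I P) j (i' d) = i (ds_pr _ j d).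
  apply: (ds_ext (f := ds_pr (dsum I P) j \o i')
    (g := i \o ds_pr (dsum I K) j)) => k x /=.
  by rewrite iE /= !ds_prE; case: eqP => // _; rewrite linear0.
have prp j d : ds_pr (dsum I M) j (p' d) = p (ds_pr _ j d).
  apply: (ds_ext (f := ds_pr (dsum I M) j \o p')
    (g := p \o ds_pr (dsum I P) j)) => k x /=.
  by rewrite pE /= !ds_prE; case: eqP => // _; rewrite linear0.
exists i', p'; split=> //.
split=> [x y xy|y|x].
- by apply: ds_eq => j; apply: ii; rewrite -!pri xy.
- have [s _ ->] := ds_fin y.
  apply: (big_ind (fun y => exists x, p' x = y)) => [|u v [x <-] [z <-]|j _].
  + by exists 0; rewrite linear0.
  + by exists (x + z); rewrite linearD.
  by have [x xE] := ps (ds_pr _ j y); exists (ds_in _ j x); rewrite pE /= xE.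
split=> [px0|[y ->]]; last first.
  by apply: ds_eq => j; rewrite prp pri linear0; apply/ip; exists (ds_pr _ j y).
have [s _ ->] := ds_fin x.
apply: (big_ind (fun y => exists x, y = i' x)) => [|u v [z ->] [t ->]|j _].
- by exists 0; rewrite linear0.
- by exists (z + t); rewrite linearD.
have /ip[y ->] : p (ds_pr _ j x) = 0 by rewrite -prp px0 linear0.
by exists (ds_in _ j y); rewrite iE.
Qed.

Lemma extv_dsum (I : choiceType) j K N :
  extv j.+1 K N -> extv j.+1 (dsum I K) N.
Proof.
elim: j K => [|j IH] K.
  move=> extK; have [L [P [i [p [ip projP]]]]] := enough_projectives K.
  have [i' [p' [ip' iE _]]] := ses_dsum I ip.
  apply: (ext1_presentation ip'); first exact: dsum_projective.
  move=> f; have ex k := extK _ _ _ _ ip (f \o ds_in _ k).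
  have [g gE] := ds_lift (dsum I P) (fun k => projT1 (cid (ex k))).
  exists g; apply: (ds_ext (f := g \o i')) => k x /=.
  by rewrite iE gE; case: cid => h /= ->.
move=> [L [P [i [p [ip projP extL]]]]].
have [i' [p' [ip' _ _]]] := ses_dsum I ip.
by exists (dsum I L), (dsum I P), i', p'; split=> //; [apply: dsum_projective |
  apply: IH].
Qed.

Lemma extv_iso j M M' N (f : {linear M -> M'}) : injective f ->
  (forall y, exists x, f x = y) -> extv j.+1 M N -> extv j.+1 M' N.
Proof.
move=> fi fs extM; have [K [P [i [p [ip projP]]]]] := enough_projectives M.
have [ii ps iE] := ip; have ip' : ses i (f \o p).
  split=> // [y|x]; first by have [x <-] := fs y; have [z <-] := ps x; exists z.
  rewrite -iE /=; split=> [fx0|->]; last exact: linear0.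
  by apply: fi; rewrite linear0.
case: j extM => [|j] extM; last by apply/(extvSS _ _ ip')/(extvSS _ _ ip).
by apply: (ext1_presentation ip') => //; apply: extM ip.
Qed.

(** If s0 is a multiple of every nonzero element of S and every element of M is
    the image of s0 under a map S -> M, then M is a direct sum of copies of S.  The
    index set is a maximal independent subset of M, given by Zorn's lemma, where a
    subset is independent when its elements generate independent copies of S. *)
Lemma isotypic_dsum S M (s0 : S) :
  (forall s : S, s <> 0 -> exists a : R, a *: s = s0) ->
  (forall x : M, exists m : {linear S -> M}, m s0 = x) ->
  exists (I : choiceType) (f : {linear dsum I S -> M}),
    injective f /\ forall y, exists x, f x = y.
Proof.
move=> Ssimple muex; pose mu x := projT1 (cid (muex x)).
have muE x : mu x s0 = x by rewrite /mu; case: cid.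
pose W := dsum M S; have [ev evE] := ds_lift W mu.
pose supp (w : W) (B : set M) := forall x, ds_pr _ x w <> 0 -> B x.
pose indep (B : set M) := forall w, supp w B -> ev w = 0 -> w = 0.
have [F Findep Ftot|B [Bindep Bmax]] := @Zorn_bigcup M indep.
  move=> w wF ev0.
  suff [w0|[X FX wX]] : w = 0 \/ exists2 X, F X & supp w X; first exact: w0.
    exact: Findep FX _ wX ev0.
  have [s us wE] := ds_fin w.
  suff [sX|[X FX sX]] : (forall x, x \in s -> ds_pr W x w = 0) \/
      exists2 X, F X & forall x, x \in s -> ds_pr W x w <> 0 -> X x.
  - by left; rewrite wE big1_seq // => x /andP[_ xs]; rewrite sX ?linear0.
  - right; exists X => // x wx; apply: sX => //; apply/negP => xs; apply: wx.
    rewrite wE linear_sum big1_seq // => y /andP[_ ys].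
    by rewrite ds_prE; case: eqP => // yx; rewrite -yx ys in xs.
  elim: (s) => [|x t [IH|[X FX IH]]]; first by left.
    have [x0|/eqP x0] := eqVneq (ds_pr W x w) 0.
      by left=> y; rewrite inE => /orP[/eqP->|/IH].
    have [X FX Xx] := wF _ x0.
    by right; exists X => // y; rewrite inE => /orP[/eqP->|/IH].
  right; have [x0|/eqP x0] := eqVneq (ds_pr W x w) 0.
    by exists X => // y; rewrite inE => /orP[/eqP->|/IH].
  have [Y FY Yx] := wF _ x0.
  have [XY|YX] := Ftot _ _ FX FY.
    by exists Y => // y; rewrite inE => /orP[/eqP->|/IH Xy /Xy/XY].
  by exists X => // y; rewrite inE => /orP[/eqP-> _|/IH //]; apply: YX.
(* The maximal B indexes the sum; f is injective by independence of B. *)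
pose I : choiceType := {x : M | `[< B x >]}.
have [f fE] := ds_lift (dsum I S) (fun i : I => mu (val i)).
have [j jE] := ds_lift (dsum I S) (fun i : I => ds_in W (val i)).
have evj d : ev (j d) = f d.
  by apply: (ds_ext (f := ev \o j)) => i x /=; rewrite jE evE fE.
have prj (i : I) d : ds_pr W (val i) (j d) = ds_pr _ i d.
  apply: (ds_ext (f := ds_pr W (val i) \o j)) => k x /=.
  by rewrite jE !ds_prE val_eqE.
have prj0 d : supp (j d) B.
  move=> x; apply: contra_notP => Bx.
  apply: (ds_ext (f := ds_pr W x \o j) (g := \0 : {linear _ -> S})) => k y /=.
  rewrite jE ds_prE; case: eqP => // kx; case: Bx.
  by rewrite -kx; apply/asboolP/(valP k).
have fim w : supp w B -> exists d, f d = ev w.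
  move=> wB; have [s _ ->] := ds_fin w; rewrite linear_sum.
  apply: (big_ind (fun y => exists x, f x = y)) => [|u v [x <-] [z <-]|x _].
  - by exists 0; rewrite linear0.
  - by exists (x + z); rewrite linearD.
  have [->|/eqP/wB Bx] := eqVneq (ds_pr W x w) 0.
    by exists 0; rewrite !linear0.
  have Bx' : `[< B x >] by apply/asboolP.
  by exists (ds_in _ (exist _ x Bx' : I) (ds_pr W x w)); rewrite fE evE.
exists I, f; split=> [x y xy|x].
  apply/eqP; rewrite -subr_eq0; apply/eqP; apply: ds_eq => i.
  by rewrite -prj (Bindep (j (x - y))) ?linear0 // evj linearB xy subrr.
apply: contrapT => xim.
have Bx : ~ B x.
  move=> /asboolP Bx; apply: xim; exists (ds_in _ (exist _ x Bx : I) s0).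
  by rewrite fE muE.
(* If x is not in the image then B with x added is still independent. *)
case: (Bmax (B `|` [set x])%classic) => [|w wB ev0].
  split; first by left.
  by move=> /(_ x) Bx'; apply/Bx/Bx'; right.
have [x0|/eqP x0] := eqVneq (ds_pr W x w) 0.
  by apply: Bindep ev0 => y wy; case: (wB y wy) => // yx; rewrite yx in wy.
have [a aE] := Ssimple _ x0; case: xim.
have [|d dE] := fim (- (a *: (w - ds_in W x (ds_pr W x w)))).
  move=> y; apply: contra_notP => By.
  rewrite linearN linearZ linearB ds_prE /=.
  suff -> : ds_pr W y w = if x == y then ds_pr W x w else 0.
    by rewrite subrr scaler0 oppr0.
  case: eqP => [->//|xy]; apply: contrapT => wy.
  by case: (wB y wy) => // yx; apply: xy.
exists d; rewrite dE linearN linearZ linearB ev0 evE sub0r /= scalerN opprK.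
by rewrite -linearZ aE muE.
Qed.

End Dimension.

Section Comparison.
Variable R : nzRingType.
Implicit Types M N : lmodType R.

Lemma free_ses M : ses (@syzygy_incl R M) (free_eval M).
Proof.
split=> [|y|x]; [exact: val_inj | exact: free_eval_surj |].
rewrite syzygy_exact; split=> [[y ->]|[y ->]]; first by eexists.
by have [z <-] := free_eval_surj y; exists z.
Qed.

Lemma extv_syz M N i j : extv (i + j).+1 M N <-> extv j.+1 (syz M i) N.
Proof.
elim: i j => // i IH j; rewrite addSnnS IH.
exact: (extvSS _ _ (free_ses (syz M i)) (@free_mod_projective _ _)).
Qed.

(** The cohomology of Hom(P, N) vanishes in degree j.+1 when every map on P_(j+1)
    that kills the boundaries is a coboundary. *)
Lemma res_cohomology_trivialP M N (P : proj_resolution M) j :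
  trivial_zmod (res_cohomology P N j.+1) <->
  forall y : {linear res_mod P j.+1 -> N}, (forall z, y (res_diff P j.+1 z) = 0) ->
  exists x : {linear res_mod P j -> N}, forall z, y z = x (res_diff P j z).
Proof.
rewrite /res_cohomology homology_trivialP; split=> H y y0.
  have [|x xE] := H y; first by apply: homP => z; apply: y0.
  by exists x => z; rewrite xE.
have [|x xE] := H y.
  by move=> z; rewrite -[LHS]/(hom_diff P N j.+1 y z) y0.
by exists x; apply: homP => z; apply: xE.
Qed.

Lemma Ext_extv M N j : trivial_zmod (Ext M N j.+1) <-> extv j.+1 M N.
Proof.
have := extv_syz M N j 0; rewrite addn0 => ->; rewrite /Ext.
rewrite res_cohomology_trivialP; have [ii ps iE] := free_ses (syz M j.+1).
split=> [H|extM y y0].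
  apply: (ext1_presentation (free_ses (syz M j))).
    exact: free_mod_projective.
  move=> f; have [z|x xE] := H (f \o free_eval (syz M j.+1)).
    rewrite -[RHS](linear0 f); apply: (congr1 f); apply/iE.
    by eexists.
  exists x => z; have [t <-] := ps z.
  exact: (esym (xE t)).
have [|u uE] := factor_surj (g := y) ps.
  move=> x /syzygy_exact[z ->].
  exact: y0.
have [x xE] := extM _ _ _ _ (free_ses (syz M j)) u.
exists x => z; rewrite -uE -xE.
by [].
Qed.

End Comparison.

(** * Towers *)

Section Tower.
Variables (R : pzRingType) (f : R).
Implicit Types B C H M N P X Y Z : lmodType R.

(** The modules annihilated by f. *)
Definition killed M : Prop := forall x : M, f *: x = 0.

Variables (S : lmodType R) (s0 : S).

(** A tower of height m over Z: 0 -> B -> Z -> H -> 0 has a killed cokernel H, and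
    B is covered by a projective module C without nonzero maps to S, the kernel Z'
    of C -> B carrying a tower of height m - 1.  At the top, Z itself is killed. *)
Fixpoint tower (m : nat) Z : Prop :=
  if m is m'.+1 then
    exists B H C Z' (i : {linear B -> Z}) (p : {linear Z -> H})
      (k : {linear Z' -> C}) (q : {linear C -> B}),
    [/\ ses i p /\ killed H, ses k q, projective C, extv 0 C S & tower m' Z']
  else killed Z.

Hypothesis S_simple : forall s : S, s <> 0 -> exists a : R, a *: s = s0.
Hypothesis S_univ : forall M, killed M ->
  forall x : M, exists m : {linear S -> M}, m s0 = x.

Lemma extv_trivial M j : (forall x : M, x = 0) -> extv j M S.
Proof.
move=> M0; case: j => [|j]; first by move=> g x; rewrite (M0 x) linear0.
apply: extv_projective => X Y g h _; exists (\0 : {linear M -> X}) => x.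
by rewrite (M0 x) !linear0.
Qed.

Lemma extv_killed M j : killed M -> extv j.+1 S S -> extv j.+1 M S.
Proof.
move=> Mk extS; have [I [g [gi gs]]] := isotypic_dsum S_simple (S_univ Mk).
exact: extv_iso gi gs (extv_dsum I extS).
Qed.

(** S embeds in every nonzero killed module M, and the quotient is again killed. *)
Lemma extv_simple_sub M n : killed M -> (exists x : M, x <> 0) ->
  extv n M S -> extv n.+1 S S -> extv n S S.
Proof.
move=> Mk [x x0] extM extS; have [m mx] := S_univ Mk x.
have mi : injective m.
  move=> s t st; apply/eqP; rewrite -subr_eq0; apply/eqP; apply: contrapT => st0.
  have [a aE] := S_simple st0.
  apply: x0; rewrite -mx -aE linearZ linearB st subrr.
  exact: scaler0.
have [||Q [p [ps pE]]] := @quot_ex R M (fun y => exists s, y = m s).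
- by exists 0; rewrite linear0.
- by move=> a _ _ [s ->] [t ->]; exists (a *: s + t); rewrite linearP.
apply: (extv_sub (i := m) (p := p)) extM _; first by split.
apply: extv_killed => // y; have [z <-] := ps y.
by rewrite -linearZ /= Mk linear0.
Qed.

(** The inductive step: one more degree of Ext(S, S) vanishes, unless Ext(Z, S)
    vanishes in all degrees, 0 included. *)
Lemma tower_extv n m Z : (forall j, (n < j)%N -> extv j.+1 S S) ->
  tower m Z -> (forall j, (n <= j)%N -> extv j.+1 Z S) ->
  extv n.+1 S S \/ forall j, extv j Z S.
Proof.
move=> extS; have extk M j : killed M -> (n < j)%N -> extv j.+1 M S.
  by move=> Mk nj; apply: extv_killed => //; apply: extS.
(* The dichotomy for one homology module M of the tower. *)
have dich M : killed M -> extv n.+1 M S -> extv n.+1 S S \/ forall x : M, x = 0.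
  move=> Mk extM; have [M0|/existsNP M0] := pselect (forall x : M, x = 0).
    by right.
  by left; apply: extv_simple_sub Mk M0 extM _; apply: extS.
elim: m Z => [|m IH] Z /=.
  move=> Zk extZ; have [|Z0] := dich Z Zk (extZ n (leqnn n)); first by left.
  by right=> j; apply: extv_trivial.
move=> [B [H [C [Z' [i [p [k [q [[ip Hk] kq projC homC tZ']]]]]]]]] extZ.
have extB j : (n <= j)%N -> extv j.+1 B S.
  move=> nj; apply: (extv_sub ip); first exact: extZ.
  by apply: extk; rewrite ?ltnS.
have [|//|extZ'] := IH Z' tZ'.
- move=> j nj; apply/(extvSS _ _ kq projC)/extB.
  exact: leq_trans nj _.
- by left.
have [ki qs kE] := kq; have [ii ps iE] := ip.
have {}extB j : extv j B S.
  case: j => [|[|j]]; last by apply/(extvSS _ _ kq projC); apply: extZ'.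
    by move=> g b; have [c <-] := qs b; apply: (homC (g \o q)).
  apply: (ext1_presentation kq projC) => g.
  by exists (\0 : {linear C -> S}) => x; rewrite (extZ' 0%N).
have extH : extv n.+1 H S by apply: (extv_quot ip) => //; apply: extZ.
have [|H0] := dich H Hk extH; first by left.
have is_ z : exists b, i b = z.
  by have /iE[b ->] := H0 (p z); exists b.
right=> -[g z|j]; last exact: extv_iso ii is_ (extB j.+1).
by have [b <-] := is_ z; apply: (extB 0%N (g \o i)).
Qed.

Theorem tower_self_orthogonal m n Z :
  tower m Z -> projective Z -> ~ extv 0 Z S ->
  (forall j, (n < j)%N -> extv j S S) -> forall j, (0 < j)%N -> extv j S S.
Proof.
move=> tZ projZ homZ; elim: n => [//|n IH] extS; apply: IH => j.
rewrite leq_eqVlt => /orP[/eqP<-|]; last exact: extS.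
have extS' j' : (n < j')%N -> extv j'.+1 S S by move=> nj; apply: extS.
have extZ j' : (n <= j')%N -> extv j'.+1 Z S by move=> _; apply: extv_projective.
by case: (tower_extv extS' tZ extZ) => // /(_ 0%N).
Qed.

End Tower.

(** * Modules over the corner ring *)

Section FixMod.
Variables (A : pzRingType) (f : idem_elt A).
Local Notation fc := (idem_val f : A^c).
Local Notation G := (corner f)^c.

Section Def.
Variable M : lmodType A^c.

Definition fix_pred : pred M := fun x => fc *: x == x.

Lemma fix_pred_closed : zmod_closed fix_pred.
Proof.
split=> [|x y]; rewrite /fix_pred !unfold_in ?scaler0 //.
by move=> /eqP xE /eqP yE; rewrite scalerBr xE yE.
Qed.

HB.instance Definition _ := GRing.isZmodClosed.Build M fix_pred fix_pred_closed.

(** The right module Mf over the corner ring fAf; its elements are the x in M with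
    xf = x. *)
Definition fixmod : Type := {x : M | x \in fix_pred}.
HB.instance Definition _ := [isSub of fixmod for @sval M _].
HB.instance Definition _ := [Choice of fixmod by <:].
HB.instance Definition _ := [SubChoice_isSubZmodule of fixmod by <:].

Lemma fixmod_valK (x : fixmod) : fc *: val x = val x.
Proof. exact/eqP/(valP x). Qed.

Lemma fixmod_scale_subproof (c : G) (x : fixmod) :
  (val (c : corner f) : A^c) *: val x \in fix_pred.
Proof.
apply/eqP; rewrite scalerA; congr (_ *: _).
exact: (corner_valK (c : corner f)).2.
Qed.

Definition fixmod_scale (c : G) (x : fixmod) : fixmod :=
  exist (fun y => y \in fix_pred) _ (fixmod_scale_subproof c x).

Lemma fixmod_scaleA a b x :
  fixmod_scale a (fixmod_scale b x) = fixmod_scale (a * b) x.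
Proof. by apply: val_inj; rewrite /= scalerA. Qed.

Lemma fixmod_scale1 : left_id 1 fixmod_scale.
Proof. by move=> x; apply: val_inj; rewrite /= fixmod_valK. Qed.

Lemma fixmod_scaleDr : right_distributive fixmod_scale +%R.
Proof. by move=> a x y; apply: val_inj; rewrite /= scalerDr. Qed.

Lemma fixmod_scaleDl x : {morph fixmod_scale^~ x : a b / a + b}.
Proof. by move=> a b; apply: val_inj; rewrite /= scalerDl. Qed.

HB.instance Definition _ := GRing.Zmodule_isLmodule.Build G fixmod
  fixmod_scaleA fixmod_scale1 fixmod_scaleDr fixmod_scaleDl.

Lemma fixmod_valZ (c : G) (x : fixmod) :
  val (c *: x) = (val (c : corner f) : A^c) *: val x.
Proof. by []. Qed.

Lemma fixmod_ex (x : M) : fc *: x = x -> exists y : fixmod, val y = x.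
Proof.
by move=> /eqP fx; exists (exist (fun y => y \in fix_pred) x fx).
Qed.

Lemma fix_scaleK (x : M) : fc *: (fc *: x) = fc *: x.
Proof. by rewrite scalerA; congr (_ *: _); exact (idem_mul f). Qed.

End Def.

Lemma fixmap_ex (X Y : lmodType A^c) (g : {linear X -> Y}) :
  exists h : {linear fixmod X -> fixmod Y}, forall x, val (h x) = g (val x).
Proof.
have gf (x : fixmod X) : g (val x) \in @fix_pred Y.
  by apply/eqP; rewrite -linearZ /= fixmod_valK.
have [|h hE] := @linear_ex _ (fixmod X) (fixmod Y)
    (fun x => exist (fun y => y \in @fix_pred Y) _ (gf x)).
  move=> a x y; apply: val_inj; rewrite [RHS]raddfD.
  exact: (linearP g (val (a : corner f) : A^c) (val x) (val y)).
by exists h => x; rewrite hE.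
Qed.

(** The functor M -> Mf on linear maps. *)
Definition fixmap (X Y : lmodType A^c) (g : {linear X -> Y}) :
  {linear fixmod X -> fixmod Y} := projT1 (cid (fixmap_ex g)).

Lemma val_fixmap (X Y : lmodType A^c) (g : {linear X -> Y}) x :
  val (fixmap g x) = g (val x).
Proof. by rewrite /fixmap; case: cid. Qed.

Lemma fixmap_surj (C Z : lmodType A^c) (c : {linear C -> Z}) :
  (forall z, fc *: z = z -> exists x, c x = z) ->
  forall z, exists x, fixmap c x = z.
Proof.
move=> cs z; have [x xE] := cs _ (fixmod_valK z).
have [y yE] := fixmod_ex (fix_scaleK x); exists y; apply: val_inj.
by rewrite val_fixmap yE linearZ /= xE fixmod_valK.
Qed.

Lemma fixmap_ses (K X M : lmodType A^c) (i : {linear K -> X}) (p : {linear X -> M}) :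
  ses i p -> ses (fixmap i) (fixmap p).
Proof.
move=> [ii ps iE]; split=> [x y xy||x].
- by apply/val_inj/ii; rewrite -!val_fixmap xy.
- by apply: fixmap_surj => z _; apply: ps.
split=> [px|[y ->]]; last first.
  by apply: val_inj; rewrite !val_fixmap; apply/iE; exists (val y).
have /iE[y yE] : p (val x) = 0 by rewrite -val_fixmap px.
have [|z zE] := @fixmod_ex K y.
  by apply: ii; rewrite linearZ /= -yE fixmod_valK.
by exists z; apply: val_inj; rewrite val_fixmap zE.
Qed.

End FixMod.

Section CornerModules.
Variables (A : pzRingType) (f : idem_elt A).
Local Notation fc := (idem_val f : A^c).
Local Notation G := (corner f)^c.
Implicit Types B C H M N P X Y Z : lmodType A^c.

(** In this section Q is a copy of the right module fA, given by its generator q0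
    and by its inclusion co into A. *)
Variables (Q : lmodType A^c) (q0 : Q) (co : {linear Q -> A^c^o}).
Hypothesis co_gen : co q0 = fc.
Hypothesis coK : forall q, (co q : A^c) *: q0 = q.

Lemma gen_fix : fc *: q0 = q0.
Proof. by rewrite -co_gen coK. Qed.

Lemma corner_univ M (x : M) : exists h : {linear Q -> M},
  forall q, h q = (co q : A^c) *: x.
Proof. by apply: linear_ex => a y z; rewrite linearP scalerDl scalerA. Qed.

Lemma gen_ext M (g h : {linear Q -> M}) : g q0 = h q0 -> forall q, g q = h q.
Proof. by move=> gh q; rewrite -[q]coK !linearZ /= gh. Qed.

Lemma corner_mod_projective : projective Q.
Proof.
move=> M N g h gs; have [x xE] := gs (h q0).
have [u uE] := corner_univ x; exists u.
apply: (gen_ext (g := g \o u)); rewrite /= uE co_gen linearZ /= xE.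
by rewrite -linearZ /= gen_fix.
Qed.

Section Cover.
Variables (Z : lmodType A^c).
Local Notation C := (dsum Z Q).

(** The direct sum of copies of fA indexed by Z, mapped to Z by sending the
    generator of index z to zf. *)
Lemma cover_ex : exists c : {linear C -> Z},
  forall z, c (ds_in C z q0) = fc *: z.
Proof.
have [c cE] := ds_lift C (fun z => projT1 (cid (corner_univ z))).
by exists c => z; rewrite cE; case: cid => h /= ->; rewrite co_gen.
Qed.

Lemma cover_projective : projective C.
Proof. exact/dsum_projective/corner_mod_projective. Qed.

Lemma cover_ext N (g h : {linear C -> N}) :
  (forall z, g (ds_in C z q0) = h (ds_in C z q0)) ->
  forall d, g d = h d.
Proof.
move=> gh; apply: ds_ext => z.
exact: (gen_ext (g := g \o ds_in C z) (h := h \o ds_in C z) (gh z)).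
Qed.

Lemma cover_killed N : killed fc N -> forall (g : {linear C -> N}) d, g d = 0.
Proof.
move=> Nk g; apply: (cover_ext (h := \0 : {linear C -> N})) => z /=.
by rewrite -gen_fix !linearZ /= Nk.
Qed.

(** Multiplication by f turns the direct sum of copies of fA into a direct sum of
    copies of the regular fAf-module, that is into a free module. *)
Lemma fix_cover_direct_sum : exists (D : direct_sum Z G^o)
  (g : {linear D -> fixmod f C}) (h : {linear fixmod f C -> D}),
  (forall x, g (h x) = x) /\
  forall i, val (g (ds_in D i (1 : corner f))) = ds_in C i q0.
Proof.
have thk (q : fixmod f Q) : (co (val q) : A) \in corner_pred f.
  apply/asboolP; exists (co (val q)).
  have fco : idem_val f * (co (val q) : A) = co (val q).
    by rewrite -[in RHS](coK (val q)) linearZ /= co_gen.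
  by rewrite fco -[LHS](congr1 co (fixmod_valK q)) linearZ.
have [|th thE] := @linear_ex G (fixmod f Q) G^o
    (fun q => exist (fun y => y \in corner_pred f) _ (thk q)).
  move=> a x y; apply: val_inj; rewrite [RHS]raddfD.
  exact: (linearP co (val (a : corner f) : A^c) (val x) (val y)).
have thq q : (val (th q : corner f) : A^c) *: q0 = val q.
  by rewrite thE /= coK.
have in_fix i : fc *: ds_in C i q0 = ds_in C i q0.
  by rewrite -linearZ /= gen_fix.
pose b i := projT1 (cid (fixmod_ex (in_fix i))).
have bE i : val (b i) = ds_in C i q0 by rewrite /b; case: cid.
have inex i : exists g : {linear G^o -> fixmod f C}, forall c, g c = (c : G) *: b i.
  by apply: linear_ex => a x y; rewrite scalerDl scalerA.
pose ini i := projT1 (cid (inex i)).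
have inE i c : ini i c = (c : G) *: b i by rewrite /ini; case: cid.
pose pr i : {linear fixmod f C -> G^o} := th \o fixmap f (ds_pr C i).
have prb i j : pr j (b i) = if i == j then (1 : G) else 0.
  apply: val_inj; rewrite /pr /= thE /= val_fixmap bE ds_prE.
  case: eqP => _; first by rewrite co_gen.
  by rewrite linear0.
have prin i j c : pr j (ini i c) = if i == j then c else 0.
  rewrite inE linearZ prb; case: eqP => _; last exact: scaler0.
  exact: mulr1.
have fin d : exists2 s : seq Z, uniq s & d = \sum_(i <- s) ini i (pr i d).
  have [s us sE] := ds_fin (val d); exists s => //; apply: val_inj.
  rewrite raddf_sum sE; apply: eq_bigr => i _.
  rewrite -[RHS]/(val (ini i (pr i d))) inE fixmod_valZ bE -linearZ /= thq.
  by rewrite val_fixmap.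
pose D := @DirectSum G Z G^o (fixmod f C) ini pr prin fin.
exists D, (@idfun (fixmod f C)), (@idfun (fixmod f C)); split=> // i.
by rewrite /= inE scale1r bE.
Qed.

Lemma fix_cover_projective : projective (fixmod f C).
Proof.
have [D [g [h [gh _]]]] := fix_cover_direct_sum.
apply: (projective_retract gh); apply: dsum_projective.
exact: regular_projective.
Qed.

(** The image B of the cover is the trace Z f A, and the quotient H of Z by B is
    killed. *)
Lemma cover_trace : exists (B H : lmodType A^c) (c : {linear C -> Z})
    (i : {linear B -> Z}) (p : {linear Z -> H}) (q : {linear C -> B}),
  [/\ forall z, c (ds_in C z q0) = fc *: z, ses i p, killed fc H,
      forall x, i (q x) = c x & forall b, exists x, q x = b].
Proof.
have [c cE] := cover_ex; pose im z := exists x, z = c x.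
have im0 : im 0 by exists 0; rewrite linear0.
have imD a x y : im x -> im y -> im (a *: x + y).
  by move=> [u ->] [v ->]; exists (a *: u + v); rewrite linearP.
have [B [i [ii iE]]] := submod_ex im0 imD.
have [H [p [ps pE]]] := quot_ex im0 imD.
have [|q qE] := @factor_inj _ _ _ _ i c ii; first by move=> x; apply/iE; exists x.
exists B, H, c, i, p, q; split=> //.
- by split=> // x; rewrite pE; apply: iE.
- move=> x; have [z <-] := ps x; rewrite -linearZ; apply/pE.
  by exists (ds_in C z q0); rewrite cE.
move=> b; have /iE[x xE] : exists y, i b = i y by exists b.
by exists x; apply: ii; rewrite qE -xE.
Qed.

End Cover.

Variable S : lmodType A^c.
Hypothesis S_killed : killed fc S.

(** If Zf is projective over the corner ring, a section s of Cf -> Zf extends to an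
    idempotent endomorphism sg of the cover C.  Its image P still covers the trace
    of Z, and the kernel of P -> Z is killed because s splits Cf -> Zf. *)
Lemma tower_fix_projective Z : projective (fixmod f Z) -> tower fc S 1 Z.
Proof.
move=> projZ; set C := dsum Z Q.
have [B [H [c [i [p [q [cE ip Hk iq qs]]]]]]] := cover_trace Z.
have Fcs : forall z, exists x, fixmap f c x = z.
  by apply: fixmap_surj => z zE; exists (ds_in C z q0); rewrite cE.
have [s sE] := projZ _ _ (fixmap f c) idfun Fcs.
have zfix z : exists y : fixmod f Z, val y = fc *: z by apply/fixmod_ex/fix_scaleK.
pose u z := projT1 (cid (zfix z)).
have uE z : val (u z) = fc *: z by rewrite /u; case: cid.
(* sg is the endomorphism of C that equals s composed with the cover on Cf. *)
have [sg sgE] := ds_lift C (fun z => projT1 (cid (corner_univ (val (s (u z)))))).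
have {}sgE z : sg (ds_in C z q0) = val (s (u z)).
  by rewrite sgE; case: cid => h /= ->; rewrite co_gen fixmod_valK.
have sgF x : fixmap f sg x = s (fixmap f c x).
  have [D [g [h [gh gE]]]] := fix_cover_direct_sum Z.
  rewrite -(gh x); apply: (ds_ext (f := fixmap f sg \o g)
    (g := s \o fixmap f c \o g)) => j a.
  have -> : a = (a : G) *: (1 : G^o) by apply/esym/mulr1.
  rewrite !linearZ; congr (_ *: _); apply: val_inj => /=.
  rewrite val_fixmap gE sgE; congr (val (s _)); apply: val_inj.
  by rewrite uE val_fixmap gE cE.
have sgsg x : sg (sg x) = sg x.
  apply: (cover_ext (g := sg \o sg)) => z /=.
  rewrite sgE -val_fixmap sgF; congr (val (s _)).
  exact: sE.
have csg x : c (sg x) = c x.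
  apply: (cover_ext (g := c \o sg)) => z /=.
  by rewrite sgE -val_fixmap sE uE cE.
have [||P [k [ki kE]]] := @submod_ex _ C (fun x => sg x = x).
- exact: linear0.
- by move=> a x y xE yE; rewrite linearP xE yE.
have [|r rE] := @factor_inj _ _ _ _ k sg ki; first by move=> x; apply/kE.
have rk x : r (k x) = x by apply: ki; rewrite rE; apply/kE; exists x.
have [|W [w wqk]] := @ker_ex _ _ _ (q \o k).
  move=> b; have [x xE] := qs b; have [ii _ _] := ip.
  exists (r x) => /=; apply: ii; rewrite iq rE csg -iq xE.
  by [].
exists B, H, P, W, i, p, w, (q \o k); split=> //.
- exact/(projective_retract rk)/cover_projective.
- by move=> g x; rewrite -[x]rk; apply: (cover_killed S_killed (g \o r)).
move=> x; have [wi _ wE] := wqk; apply: wi; apply: ki.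
rewrite !linearZ !linear0 /=; set y := k (w x).
have ky : sg y = y by apply/kE; exists (w x).
have cy : c y = 0.
  rewrite -iq; have -> : q y = 0 by apply: (wE (w x)).2; exists x.
  exact: linear0.
have [v vE] := fixmod_ex (fix_scaleK f y).
have : fixmap f sg v = 0.
  rewrite sgF; have -> : fixmap f c v = 0.
    by apply: val_inj; rewrite val_fixmap vE linearZ /= cy scaler0.
  exact: linear0.
by move=> /(congr1 val); rewrite val_fixmap vE linearZ /= ky.
Qed.

(** The modules Zf of the successive steps are syzygies over the corner ring. *)
Lemma tower_ex n Z :
  (forall (Y : lmodType G) j, (n < j)%N -> extv j (fixmod f Z) Y) ->
  tower fc S n.+1 Z.
Proof.
elim: n Z => [|n IH] Z extZ.
  by apply/tower_fix_projective/ext1_all_projective => Y; apply: (extZ Y 1%N).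
have [B [H [c [i [p [q [cE ip Hk iq qs]]]]]]] := cover_trace Z.
have [K [k kq]] := ker_ex qs; have [ki _ kE] := kq; have [ii _ _] := ip.
exists B, H, (dsum Z Q), K, i, p, k, q; split=> //.
- exact: cover_projective.
- by move=> g x; apply: (cover_killed S_killed).
apply: IH => Y [//|j] nj.
have cses : ses (fixmap f k) (fixmap f c).
  split.
  - by move=> x y xy; apply/val_inj/ki; rewrite -!val_fixmap xy.
  - by apply: fixmap_surj => z zE; exists (ds_in _ z q0); rewrite cE.
  move=> x; have [_ _ <-] := fixmap_ses f kq.
  split=> [cx|qx]; apply: val_inj; rewrite val_fixmap.
    by apply: ii; rewrite iq -val_fixmap cx linear0.
  by rewrite -iq -val_fixmap qx linear0.
by apply/(extvSS _ _ cses (@fix_cover_projective Z))/extZ.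
Qed.

End CornerModules.

(** * Graded pieces *)

Section Graded.
Variables (k : closedFieldType) (A : algType k) (G : pos_grading A).

(** The elements of A without components of degree < d. *)
Definition gtail (d : nat) (x : A) : Prop :=
  exists n (a : nat -> A), (forall i, a i \in gr G (i + d)) /\ x = \sum_(i < n) a i.

Lemma gtail_hom d i x : x \in gr G (i + d) -> gtail d x.
Proof.
move=> xi; exists i.+1, (fun j => if j == i then x else 0).
split=> [j|]; first by case: eqP => [->|_] //; apply: rpred0.
rewrite (bigD1 ord_max) //= eqxx big1 ?addr0 // => j /negPf.
by rewrite -val_eqE /= => ->.
Qed.

Lemma gtail0 d : gtail d 0.
Proof. exact/(@gtail_hom d 0)/rpred0. Qed.

Lemma gtailD d x y : gtail d x -> gtail d y -> gtail d (x + y).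
Proof.
move=> [n [a [aG ->]]] [m [b [bG ->]]].
exists (n + m)%N, (fun i => (if (i < n)%N then a i else 0) +
                            (if (i < m)%N then b i else 0)).
split=> [i|]; first by rewrite rpredD //; case: ifP => _; rewrite ?rpred0.
rewrite big_split /= (big_ord_widen (n + m) a) ?leq_addr //.
by rewrite (big_ord_widen (n + m) b) ?leq_addl // -!big_mkcond.
Qed.

Lemma gtail_all x : gtail 0 x.
Proof.
have [n [a [aG ->]]] := gr_span G x.
by exists n, a; split=> // i; rewrite addn0.
Qed.

Lemma grM i j x y : x \in gr G i -> y \in gr G j -> x * y \in gr G (i + j).
Proof.
move=> xi yj; apply/gr_mul; exists 1%N, (fun=> x), (fun=> y).
by split=> //; rewrite big_ord1.
Qed.

Lemma gtailM p q x y : gtail p x -> gtail q y -> gtail (p + q) (x * y).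
Proof.
move=> [n [a [aG ->]]] [m [b [bG ->]]]; rewrite mulr_suml.
apply: (big_ind (gtail _)) => [||i _]; [exact: gtail0 | exact: gtailD |].
rewrite mulr_sumr.
apply: (big_ind (gtail _)) => [||j _]; [exact: gtail0 | exact: gtailD |].
by apply: (@gtail_hom _ (i + j)); rewrite addnACA; apply: grM.
Qed.

Lemma gtailMl p x y : gtail p x -> gtail p (x * y).
Proof. by move=> px; rewrite -[p]addn0; apply/gtailM/gtail_all. Qed.

Lemma gtailMr p x y : gtail p y -> gtail p (x * y).
Proof. by move=> py; rewrite -[p]add0n; apply: gtailM => //; apply: gtail_all. Qed.

Lemma gtail_split d x : gtail d x ->
  exists a r, [/\ a \in gr G d, gtail d.+1 r & x = a + r].
Proof.
move=> [[|n] [a [aG ->]]].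
  by exists 0, 0; split; [exact: rpred0 | exact: gtail0 | rewrite big_ord0 addr0].
exists (a 0%N), (\sum_(i < n) a i.+1); split; first exact: aG.
  by exists n, (fun i => a i.+1); split=> // i; rewrite addnS -addSn.
by rewrite big_ord_recl.
Qed.

Lemma gtail_direct d x : x \in gr G d -> gtail d.+1 x -> x = 0.
Proof.
move=> xd [n [a [aG xE]]].
pose c j := if (j < d)%N then 0 else if j == d then x else - a (j - d.+1)%N.
have cG j : c j \in gr G j.
  rewrite /c; case: ltngtP => [_|dj|->]; rewrite ?rpred0 //.
  by rewrite -scaleN1r rpredZ //; have := aG (j - d.+1)%N; rewrite subnK.
have := gr_direct cG (n := (d.+1 + n)%N) _ (i := d).
rewrite /c ltnn eqxx; apply; last by rewrite leq_addr.
rewrite big_split_ord big_ord_recr /= ltnn eqxx big1 ?add0r; last first.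
  by move=> i _; rewrite ltn_ord.
rewrite xE -big_split big1 // => i _.
have di : (d < d.+1 + i)%N by rewrite addSn ltnS leq_addr.
by rewrite ltnNge (ltnW di) gtn_eqF //= addKn subrr.
Qed.

Lemma gr0C x y : x \in gr G 0 -> y \in gr G 0 -> x * y = y * x.
Proof.
have [n [phi [_ _ phiE]]] := gr0_split G.
move=> /phiE[c ->] /phiE[d ->]; rewrite -!rmorphM; congr (phi _).
by apply/ffunP => i; rewrite !ffunE mulrC.
Qed.

Lemma gr0_1 : 1 \in gr G 0.
Proof.
have [n [phi [_ _ phiE]]] := gr0_split G.
by apply/phiE; exists 1; rewrite rmorph1.
Qed.

(** A primitive idempotent e of A_0 = k^n is a standard basis vector, so e A_0 = k e. *)
Lemma gr0_primitive e x : e * e = e -> primitive e -> e \in gr G 0 ->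
  x \in gr G 0 -> exists c : k, e * x = c *: e.
Proof.
have [n [phi [phiZ phi_inj phiE]]] := gr0_split G.
move=> ee [e0 eprim] /phiE[u uE] /phiE[v ->].
have uu : u * u = u by apply: phi_inj; rewrite rmorphM -uE ee.
have [i ui] : exists i, u i != 0.
  apply/existsP; apply: contraR e0; rewrite negb_exists => /forallP u0.
  rewrite uE; suff -> : u = 0 by rewrite rmorph0.
  by apply/ffunP => i; rewrite ffunE; apply/eqP; rewrite -[_ == _]negbK u0.
(* Split e as its i-th component p plus the rest q. *)
pose d : {ffun 'I_n -> k^o} := [ffun j => if j == i then 1 else 0].
have dd : d * d = d.
  by apply/ffunP => j; rewrite !ffunE; case: eqP => _; rewrite ?mulr1 ?mulr0.
have mC (a b : {ffun 'I_n -> k^o}) : a * b = b * a.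
  by apply/ffunP => j; rewrite !ffunE mulrC.
pose p := u * d; pose q := u - u * d.
have pp : p * p = p by rewrite /p mulrA -(mulrA u) (mC d) mulrA uu -mulrA dd.
have up : u * p = p by rewrite /p mulrA uu.
have pu : p * u = p by rewrite mC up.
have [||||| p0 | q0] := eprim (phi p) (phi q).
- by rewrite -rmorphM pp.
- by rewrite -rmorphM /q -/p mulrBl !mulrBr uu up pu pp subrr subr0.
- by rewrite -rmorphM /q -/p mulrBr pu pp subrr rmorph0.
- by rewrite -rmorphM /q -/p mulrBl up pp subrr rmorph0.
- by rewrite uE -rmorphD /q addrC subrK.
- have /phi_inj/ffunP/(_ i) : phi p = phi 0 by rewrite p0 rmorph0.
  by rewrite !ffunE eqxx mulr1 => ui0; rewrite ui0 eqxx in ui.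
have /phi_inj/ffunP q0' : phi q = phi 0 by rewrite q0 rmorph0.
exists (v i); rewrite uE -rmorphM -phiZ; congr (phi _).
apply/ffunP => j; have := q0' j; rewrite !ffunE.
case: eqP => [-> _|_]; first by rewrite mulrC.
by rewrite mulr0 subr0 => ->; rewrite mul0r scaler0.
Qed.

End Graded.

(** * The simple module S_e *)

(** The right module fA, for an idempotent f.  It is rebuilt from [submod_ex] so
    that only its generator and its inclusion into A are visible. *)
Lemma idem_mod_ex (A : pzRingType) (f : idem_elt A) :
  exists (Q : lmodType A^c) (q0 : Q) (co : {linear Q -> A^c^o}),
    [/\ co q0 = (idem_val f : A^c), forall q, (co q : A^c) *: q0 = q
      & injective co].
Proof.
have [||Q [co [coi coE]]] :=
    @submod_ex A^c A^c^o (fun x => exists a : A, x = idem_val f * a).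
- by exists 0; rewrite mulr0.
- move=> c x y [a ->] [b ->]; exists (a * (c : A) + b).
  by rewrite mulrDr mulrA.
have /coE[q0 q0E] : exists a : A, (idem_val f : A^c^o) = idem_val f * a.
  by exists (idem_val f); rewrite idem_mul.
exists Q, q0, co; split=> // q; apply: coi; rewrite linearZ /= -q0E.
have /coE[a aE] : exists y, co q = co y by exists q.
by rewrite -[LHS]/((idem_val f : A) * (co q : A)) aE mulrA idem_mul.
Qed.

Section Simple.
Variables (k : closedFieldType) (A : algType k) (G : pos_grading A).

(** S_e as the quotient of eA by e rad A, with eA presented in the same way. *)
Lemma S_mod_presentation (e : idem_elt A) :
  exists (E : lmodType A^c) (g0 : E) (co : {linear E -> A^c^o})
    (p : {linear E -> S_mod G (idem_val e)}),
  [/\ co g0 = (idem_val e : A^c), forall q, (co q : A^c) *: g0 = q,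
      forall s, exists q, p q = s
    & forall q, p q = 0 <-> exists2 r : A, gtail G 1 r & co q = idem_val e * r].
Proof.
pose E := eA_mod (idem_val e).
pose co : {linear E -> A^c^o} := val.
have ge : (idem_val e : A^c^o) \in @eA k A (idem_val e).
  by apply/asboolP; exists 1; rewrite mulr1.
pose g0 : E := exist (fun x => x \in @eA k A (idem_val e)) _ ge.
have [|p pE] := @linear_ex A^c E (S_mod G (idem_val e)) (\pi_(S_mod G (idem_val e))).
  by move=> a x y; rewrite raddfD; congr (_ + _); apply/esym/quotmod_scale_pi.
exists E, g0, co, p; split=> //.
- move=> q; apply: val_inj; have /asboolP[a aE] := valP q.
  rewrite -[LHS]/((idem_val e : A) * (val q : A)) [val q]aE.
  by rewrite mulrA idem_mul.
- by elim/quotW=> q; exists q; rewrite pE.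
move=> q; rewrite pE quotmod_piP; split=> [/asboolP[r /asboolP[n [a [aG rE]]] qE]|].
  by exists r => //; exists n, a; split=> // i; rewrite addn1.
move=> [r [n [a [aG rE]]] qE]; apply/asboolP; exists r => //.
by apply/asboolP; exists n, a; split=> // i; have := aG i; rewrite addn1.
Qed.

End Simple.

Section Simple.
Variables (k : closedFieldType) (A : algType k) (G : pos_grading A).
Variables (e : idem_elt A).
Hypothesis e_prim : primitive (idem_val e).
Hypothesis e_deg0 : idem_val e \in gr G 0.

Local Notation e_ := (idem_val e).
Local Notation f := (idem_val (idem_compl e)).
Local Notation fc := (f : A^c).
Local Notation gtail := (gtail G).

(** In this section E stands for eA, with generator g0 and inclusion co into A,
    and S for its quotient by e rad A, with projection p. *)
Variables (S E : lmodType A^c) (g0 : E) (co : {linear E -> A^c^o})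
  (p : {linear E -> S}).
Hypothesis co_gen : co g0 = (e_ : A^c).
Hypothesis coK : forall q, (co q : A^c) *: g0 = q.
Hypothesis p_surj : forall s, exists q, p q = s.
Hypothesis pP : forall q, p q = 0 <-> exists2 r : A, gtail 1 r & co q = e_ * r.

Let s0 : S := p g0.
Implicit Types K M : lmodType A^c.

Lemma ee : e_ * e_ = e_. Proof. exact: idem_mul. Qed.
Lemma e_compl0 : e_ * f = 0. Proof. by rewrite /= mulrBr mulr1 ee subrr. Qed.
Lemma compl_deg0 : f \in gr G 0.
Proof. by rewrite /= rpredD ?gr0_1 // -scaleN1r rpredZ. Qed.

Lemma coM (b : A) q : co ((b : A^c) *: q) = (co q : A) * b.
Proof. by rewrite linearZ. Qed.

Lemma eco q : e_ * (co q : A) = co q.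
Proof. by rewrite -{2}(coK q) linearZ /= co_gen. Qed.

Lemma scaleM (M : lmodType A^c) (a b : A) (x : M) :
  ((a * b : A) : A^c) *: x = (b : A^c) *: ((a : A^c) *: x).
Proof. by rewrite scalerA. Qed.

Lemma scaleD (M : lmodType A^c) (a b : A) (x : M) :
  ((a + b : A) : A^c) *: x = (a : A^c) *: x + (b : A^c) *: x.
Proof. exact: scalerDl. Qed.

Lemma co_split q : exists (c : k) (r : A), gtail 1 r /\ co q = c *: e_ + e_ * r.
Proof.
have [y [r [y0 r1 yE]]] := gtail_split (gtail_all G (co q : A)).
have [c cE] := gr0_primitive ee e_prim e_deg0 y0.
by exists c, r; split=> //; rewrite -cE -mulrDr -yE eco.
Qed.

Lemma s0_neq0 : s0 <> 0.
Proof.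
move=> /pP[r r1]; rewrite co_gen => eE.
have e0 : e_ = 0.
  by apply: (gtail_direct e_deg0); rewrite [idem_val e]eE; apply: gtailMr.
by case: e_prim; rewrite e0 eqxx.
Qed.

Lemma S_simple s : s <> 0 -> exists a : A^c, a *: s = s0.
Proof.
have [x <-] := p_surj s; have [c [r [r1 cE]]] := co_split x.
have [c0|c0 _] := eqVneq c 0.
  by case; apply/pP; exists r; rewrite // cE c0 scale0r add0r.
exists ((c^-1)%:A : A); apply/eqP; rewrite -subr_eq0 -linearZ /= -linearB.
apply/eqP/pP; exists (r * (c^-1)%:A); first exact: gtailMl.
rewrite linearB co_gen coM cE mulrDl mulrA.
rewrite mulr_algr scalerA mulVf // scale1r.
by rewrite addrAC subrr add0r.
Qed.

Lemma S_killed : killed fc S.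
Proof.
move=> s; have [x <-] := p_surj s; have [c [r [r1 cE]]] := co_split x.
rewrite -linearZ; apply/pP; exists (r * f); first exact: gtailMl.
by rewrite coM cE mulrDl -scalerAl e_compl0 scaler0 add0r mulrA.
Qed.

Lemma rad_S (r : A) (s : S) : gtail 1 r -> (r : A^c) *: s = 0.
Proof.
have [x <-] := p_surj s => r1; rewrite -linearZ; apply/pP.
by exists ((co x : A) * r); [apply: gtailMr | rewrite coM mulrA eco].
Qed.

(** As Ext^1(S, S) = 0, maps e rad A -> S extend to eA, and maps eA -> S kill
    e rad A. *)
Lemma rad_hom K (i : {linear K -> E}) : ses i p -> ext1 S S ->
  forall (g : {linear K -> S}) y, g y = 0.
Proof.
move=> ip ext g y; have [h <-] := ext _ _ _ _ ip g.
have /pP[r r1 rE] : p (i y) = 0 by have [_ _ ->] := ip; exists y.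
by rewrite -[i y]coK rE linearZ; apply: rad_S; apply: gtailMr.
Qed.

(** An element x of M with xe = x and x(e rad A) = 0 defines a map S -> M. *)
Lemma S_lift M (x : M) : (e_ : A^c) *: x = x ->
  (forall r : A, gtail 1 r -> ((e_ * r : A) : A^c) *: x = 0) ->
  exists m : {linear S -> M}, m s0 = x.
Proof.
move=> ex rx; have [u uE] := corner_univ co x.
have [|m mE] := factor_surj (g := u) p_surj.
  by move=> q /pP[r r1 rE]; rewrite uE rE; apply: rx.
by exists m; rewrite mE uE co_gen.
Qed.

Lemma killed_e M (x : M) : killed fc M -> (e_ : A^c) *: x = x.
Proof.
move=> Mk; have -> : (e_ : A) = 1 - f by rewrite /= subKr.
by rewrite scalerBl Mk subr0; apply: scale1r.
Qed.

(** There are no loops at e.  The quotient M of e rad A by the sum of e A_1 f and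
    the part of degree at least 2 is killed by f and by rad A, so it is a direct sum
    of copies of S; since Hom(e rad A, S) = 0, it is zero.  Comparison of the
    components of degree 1 concludes. *)
Lemma gr1_no_loop (a : A) : ext1 S S -> a \in gr G 1 ->
  exists2 b : A, b \in gr G 1 & e_ * a = e_ * b * f.
Proof.
move=> ext a1; have [K [i ip]] := ker_ex p_surj; have [ii _ iE] := ip.
(* K is e rad A and N is its submodule e A_1 f + e A_(>= 2). *)
pose N y := exists b r : A, [/\ b \in gr G 1, gtail 2 r &
  (co (i y) : A) = e_ * b * f + e_ * r].
have N0 : N 0.
  exists 0, 0; split; [exact: rpred0 | exact: gtail0 |].
  by rewrite !linear0 !(mulr0, mul0r) addr0.
have ND (c : A^c) x y : N x -> N y -> N (c *: x + y).
  move=> [b [r [b1 r2 xE]]] [b' [r' [b1' r2' yE]]].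
  have [c0 [c1 [c00 c11 cE]]] := gtail_split (gtail_all G (c : A)).
  exists (b * c0 + b'), (b * f * c1 + r * (c : A) + r'); split.
  - by rewrite rpredD // -[1%N]addn0; apply: grM.
  - apply/gtailD => //; apply/gtailD; last exact: gtailMl.
    rewrite -[2%N]/(1 + 1)%N; apply: gtailM => //.
    exact/gtailMl/(@gtail_hom _ _ _ 1 0).
  have fE : f * (c : A) = c0 * f + f * c1.
    by rewrite {1}cE mulrDr (gr0C compl_deg0 c00).
  have bE : e_ * b * f * (c : A) = e_ * (b * c0) * f + e_ * (b * f * c1).
    by rewrite -[LHS]mulrA fE mulrDr !mulrA.
  rewrite !linearD yE linearZ coM xE mulrDl bE -[e_ * r * _]mulrA.
  rewrite !(mulrDr e_) mulrDl -!addrA; congr (_ + _).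
  by rewrite [RHS]addrCA; congr (_ + _); rewrite addrCA.
have [M [q [qs qE]]] := quot_ex N0 ND.
have co_rad y : exists2 r : A, gtail 1 r & (co (i y) : A) = e_ * r.
  by have /pP : p (i y) = 0 by apply/iE; exists y.
have Mk : killed fc M.
  move=> m; have [y <-] := qs m; rewrite -linearZ; apply/qE.
  have [r r1 rE] := co_rad y; have [b [r' [b1 r2 rE']]] := gtail_split r1.
  exists b, (r' * f); split=> //; first exact: gtailMl.
  by rewrite linearZ coM rE rE' (mulrDr e_ b) mulrDl mulrA.
have Mr (r : A) (m : M) : gtail 1 r -> (r : A^c) *: m = 0.
  move=> r1; have [y <-] := qs m; rewrite -linearZ; apply/qE.
  have [r' r1' rE] := co_rad y.
  exists 0, (r' * r); split; [exact: rpred0 | exact: (gtailM r1' r1) |].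
  by rewrite linearZ coM rE mulr0 mul0r add0r mulrA.
have [x|I [h [hi hs]]] := @isotypic_dsum _ S M s0 S_simple.
  apply: S_lift; first exact: killed_e.
  by move=> r r1; apply/Mr/gtailMr.
have [|h' h'E] := @factor_inj _ _ _ _ h (@idfun M) hi.
  by move=> m; have [x xE] := hs m; exists x; rewrite xE.
(* A nonzero coordinate of q y would give a nonzero map from e rad A to S. *)
have M0 y : q y = 0.
  rewrite -[q y]/(idfun (q y)) -h'E; suff -> : h' (q y) = 0 by apply: linear0.
  apply: ds_eq => j; rewrite linear0.
  exact: (rad_hom ip ext (ds_pr _ j \o h' \o q)).
have ax : co ((a : A^c) *: g0) = e_ * a by rewrite coM co_gen.
have /iE[y yE] : p ((a : A^c) *: g0) = 0.
  by apply/pP; exists a => //; apply: (@gtail_hom _ _ _ 1 0).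
have /qE[b [r [b1 r2]]] := M0 y; rewrite -yE ax => aE.
exists b => //; apply/eqP; rewrite -subr_eq0; apply/eqP.
have er : e_ * a - e_ * b * f = e_ * r by rewrite aE addrC addKr.
apply: (@gtail_direct _ _ G 1); last by rewrite er; apply: gtailMr.
rewrite rpredD //; first by rewrite -[1%N]add0n; apply: grM.
rewrite -scaleN1r rpredZ //; rewrite -[1%N]addn0; apply: grM; last exact: compl_deg0.
by rewrite -[1%N]add0n; apply: grM.
Qed.

(** A killed module is annihilated by e rad A, which is e A_1 A = e A_1 f A. *)
Lemma S_univ M : ext1 S S -> killed fc M -> forall x : M,
  exists m : {linear S -> M}, m s0 = x.
Proof.
move=> ext Mk x; apply: S_lift; first exact: killed_e.
move=> r [n [a [aG ->]]]; rewrite mulr_sumr.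
apply: (big_ind (fun y : A => (y : A^c) *: x = 0)) => [|y z y0 z0|i _].
- exact: scale0r.
- by rewrite scaleD y0 z0 addr0.
have := aG i; rewrite addnC => /gr_mul[m [s [t [sG tG ->]]]].
rewrite mulr_sumr.
apply: (big_ind (fun y : A => (y : A^c) *: x = 0)) => [|y z y0 z0|j _].
- exact: scale0r.
- by rewrite scaleD y0 z0 addr0.
have [b _ bE] := gr1_no_loop ext (sG j).
by rewrite mulrA bE !scaleM Mk scaler0.
Qed.

Lemma self_orthogonal :
  ext1 S S -> finite_gldim A^c -> finite_gldim (corner (idem_compl e))^c ->
  forall j, (0 < j)%N -> extv j S S.
Proof.
move=> ext [N HN] [n Hn].
have [Q [q0 [coQ [coQ_gen coQK _]]]] := idem_mod_ex (idem_compl e).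
have tE : tower fc S n.+1 E.
  apply: (tower_ex coQ_gen coQK S_killed) => Y j nj.
  exact: (pdim_le_extv Y (Hn _) nj).
have projE : projective E := corner_mod_projective co_gen coK.
have homE : ~ extv 0 E S by move=> /(_ p g0); apply: s0_neq0.
have extN j : (N < j)%N -> extv j S S by move=> Nj; apply: (pdim_le_extv S (HN S) Nj).
exact: (tower_self_orthogonal S_simple (fun M => @S_univ M ext) tE projE homE extN).
Qed.

Lemma Ext_self_orthogonal : trivial_zmod (Ext S S 1) ->
  finite_gldim A^c -> finite_gldim (corner (idem_compl e))^c ->
  forall j, (0 < j)%N -> trivial_zmod (Ext S S j).
Proof.
move=> ext1 gA gG [//|j] _; apply/Ext_extv.
have {}ext1 := (Ext_extv S S 0).1 ext1.
exact: (self_orthogonal ext1 gA gG).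
Qed.

End Simple.

Theorem theorem6p7 (k : closedFieldType) (A : algType k) (G : pos_grading A)
    (A_noeth : noetherian A)
    (e : idem_elt A) (e_prim : primitive (idem_val e))
    (e_deg0 : idem_val e \in gr G 0)
    (Ext1_eq0 : trivial_zmod (Ext (S_mod G (idem_val e)) (S_mod G (idem_val e)) 1))
    (A_gldim : finite_gldim A^c)
    (Gamma_gldim : finite_gldim (corner (idem_compl e))^c) :
  forall i : nat, (0 < i)%N ->
    trivial_zmod (Ext (S_mod G (idem_val e)) (S_mod G (idem_val e)) i).
Proof.
have [E [g0 [co [p [co_gen coK ps pP]]]]] := S_mod_presentation G e.
exact: (Ext_self_orthogonal e_prim e_deg0 co_gen coK ps pP
  Ext1_eq0 A_gldim Gamma_gldim).
Qed.
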